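(* In the network attack model described in the context, $$E\left[N_\rho\right]=\frac{\lambda+b\mu}{a\mu}+M-(M-1)e^{-\xi V}\sum_{j=0}^{M-2}\frac{(\xi V)^j}{j!}+e^{-\xi V}\sum_{j=0}^{M-2}\frac{(\xi V)^j}{(j-1)!},$$ where the $j=0$ term of the last sum is $0$ (i.e. $\frac{1}{(-1)!}=0$).
   Context: Model. Let $\lambda,\mu,\xi>0$, $a\in(0,1)$, $b=1-a$, $M\in\{1,2,3,\dots\}$, $V>0$. Attacks occur at the points $0<t_1<t_2<\cdots$ of a Poisson process of rate $\lambda$ on $[0,\infty)$. The $k$th attack ($k\ge1$) incapacitates $n_k$ nodes of total weight $w_k=w_{k1}+\cdots+w_{kn_k}$, where the $n_k$ are iid geometric, $P(n_k=j)=ab^{j-1}$ for $j\ge1$, and the $w_{kj}$ are iid exponential with rate $\xi$ (mean $1/\xi$). Set $N(t)=\sum_{k:\,t_k\le t}n_k$ and $W(t)=\sum_{k:\,t_k\le t}w_k$ (zero initial state). The process is observed only at times $\tau_0=0<\tau_1<\tau_2<\cdots$, where $\tau_k-\tau_{k-1}$, $k\ge1$, are iid exponential with rate $\mu$. The families $(t_k)$, $(n_k)$, $(w_{kj})$, $(\tau_k-\tau_{k-1})$ are mutually independent. Write $N_k=N(\tau_k)$, $W_k=W(\tau_k)$. The first observed passage index is $$\rho=\inf\{k\ge0:(N_k,W_k)\notin[0,M)\times[0,V)\},$$ $\tau_\rho$ is the first observed passage time, and $N_\rho=N(\tau_\rho)$, $W_\rho=W(\tau_\rho)$. Empty sums (as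 when $M=1$) are $0$. *)

(* Defs.v *)
From HB Require Import structures.
From mathcomp Require Import all_boot all_order all_algebra.
From mathcomp Require Import finmap.
From mathcomp Require Import all_classical all_reals all_analysis.
From mathcomp Require Import measurable_realfun.

Set Implicit Arguments.
Unset Strict Implicit.
Unset Printing Implicit Defensive.

Import Order.TTheory GRing.Theory Num.Theory.
Import numFieldNormedType.Exports.

Local Open Scope classical_set_scope.
Local Open Scope ring_scope.

Section Independence.
Context {d d' : measure_display} {T : measurableType d} {S : measurableType d'}.
Context {R : realType} (P : probability T R).

(* Every finite subfamily satisfies the product rule; meant for sub-sigma-
   algebras [F i] of the sigma-algebra of [T]. *)
Definition mutual_indep (I : choiceType) (F : I -> set (set T)) : Prop :=
  forall (J : {fset I}) (E : I -> set T),
    (forall i, i \in J -> F i (E i)) ->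
    P (\bigcap_(i in [set` J]) E i) = (\prod_(i <- J) P (E i))%E.

Definition sigma_family (I : Type) (X : I -> T -> S) : set (set T) :=
  <<s \bigcup_i preimage_set_system setT (X i) measurable >>.

Definition indep_rvs (I : choiceType) (X : I -> T -> S) : Prop :=
  mutual_indep (fun i : I => preimage_set_system setT (X i) measurable).

End Independence.

Section Laws.
Context {d : measure_display} {T : measurableType d} {R : realType}.
Variable P : probability T R.

Definition exponential_rv (r : R) (X : T -> R) : Prop :=
  forall A : set R, measurable A -> P (X @^-1` A) = exponential_prob r A.

Definition geometric_rv (a : R) (X : T -> nat) : Prop :=
  forall j : nat, (1 <= j)%N -> P (X @^-1` [set j]) = (a * (1 - a) ^+ j.-1)%:E.

(* Number of points in ]s, u]; extended-real valued, since finiteness only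
   holds almost surely. *)
Definition point_count (t : nat -> T -> R) (s u : R) (x : T) : \bar R :=
  (\sum_(0 <= k <oo | (s < t k x <= u)%R) 1)%E.

(* [t k] is the (k+1)-st point of a Poisson process of the given rate on
   the half-line [0, +oo[. *)
Record poisson_points (rate : R) (t : nat -> T -> R) : Prop := PoissonPoints {
  poisson_points_ordered :
    {ae P, forall x, 0 < t 0%N x /\ forall k, t k x < t k.+1 x} ;
  poisson_points_law : forall s u : R, 0 <= s -> s < u -> forall j : nat,
    P [set x | point_count t s u x = j%:R%:E]
      = (poisson_pmf (rate * (u - s)) j)%:E ;
  poisson_points_indep : forall (m : nat) (s : nat -> R),
    0 <= s 0%N -> (forall i, s i < s i.+1) ->
    indep_rvs P (fun i : 'I_m => point_count t (s i) (s i.+1)) }.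

End Laws.

Section NetworkAttack.
Context {T : Type} {R : realType}.

(* Attacks and the nodes lost in an attack are numbered from 0: [t k], [n k]
   and [w k j] stand for t_(k+1), n_(k+1) and w_(k+1)(j+1).  The observation
   times [tau 0] = 0, [tau 1], ... keep their indices. *)
Variables (t : nat -> T -> R) (n : nat -> T -> nat) (w : nat -> nat -> T -> R).
Variables (tau : nat -> T -> R) (M : nat) (V : R).

Definition attack_weight (k : nat) (x : T) : R := \sum_(j < n k x) w k j x.

Definition nodes_lost (s : \bar R) (x : T) : \bar R :=
  (\sum_(0 <= k <oo | (t k x)%:E <= s) (n k x)%:R%:E)%E.

Definition weight_lost (s : \bar R) (x : T) : \bar R :=
  (\sum_(0 <= k <oo | (t k x)%:E <= s) (attack_weight k x)%:E)%E.

Definition passed (k : nat) (x : T) : Prop :=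
  ~ ((0 <= nodes_lost (tau k x)%:E x < M%:R%:E)%E /\
     (0 <= weight_lost (tau k x)%:E x < V%:E)%E).

(* [None] is the infimum of the empty set. *)
Definition passage_index (x : T) : option nat :=
  match pselect (exists k, `[< passed k x >]) with
  | left h => Some (ex_minn h)
  | right _ => None
  end.

Definition passage_time (x : T) : \bar R :=
  if passage_index x is Some k then (tau k x)%:E else +oo%E.

Definition nodes_at_passage (x : T) : \bar R := nodes_lost (passage_time x) x.

End NetworkAttack.

(* 1 / (j - 1)!, which is 0 for j = 0. *)
Definition inv_fact_pred (R : realType) (j : nat) : R :=
  if j is i.+1 then (i`!)%:R^-1 else 0.

(* Main.v *)
Require Import Defs.
From HB Require Import structures.
From mathcomp Require Import all_boot all_order all_algebra.
From mathcomp Require Import finmap.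
From mathcomp Require Import all_classical all_reals all_analysis.
From mathcomp Require Import measurable_realfun.
From mathcomp Require Import ring zify.

Set Implicit Arguments.
Unset Strict Implicit.
Unset Printing Implicit Defensive.

Import Order.TTheory GRing.Theory Num.Theory.
Import numFieldNormedType.Exports.

Local Open Scope classical_set_scope.
Local Open Scope ring_scope.

(** The loss process is seen through the attacks.  Let D_k say that the losses
    of the first k attacks stay below both thresholds, and call attack k counted
    when it occurs no later than the passage time, so that the nodes lost at
    passage are the sum over k of n_k times the indicator that attack k is
    counted.  Attack k is counted when no earlier observation has seen the
    thresholds crossed: either D_k holds, or the crossing is made by some attack
    c < k and no observation falls between the attacks c and k
    ([countedE], [nodes_at_passageE]).

    Three computations give the mean.

    (1) The weights lost together with j nodes form an Erlang variable, whose
    survival function at V is the probability that a Poisson variable of mean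
    xi V is at least j ([sum_exponential_cdf]).  By induction on the number of
    attacks, the number of nodes lost, the event that the weights stay below V,
    the size of a later attack and any event of the attack and observation times
    have a product law ([inside_law], [crossing_law]).  Sums of independent
    geometric variables visit each m >= 1 with probability a
    ([geometric_renewal]), which evaluates the sum over k of P(D_k)
    ([sum_inside_prob]).

    (2) Two points t_c <= t_k of the Poisson process and two consecutive
    observations straddle each other in a way that only involves the numbers of
    points before the first observation and between the two
    ([two_points_count], [two_points_law]).  The number of attacks in an
    exponential gap being geometric with ratio r = lambda / (lambda + mu), each
    further attack fitting in the same gap contributes a factor r
    ([straddle_geometric]); since exactly one gap contains t_c, attacks c and k
    are not separated by an observation with probability r^(k-c).

    (3) With y_k = P(D_k), attack k is thus counted with probability
    y_k + sum_(c < k) (y_c - y_(c+1)) r^(k-c), independently of n_k.  The sum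
    over k is sum_k y_k + r / (1 - r) = sum_k y_k + lambda / mu
    ([series_delayed]), and multiplication by the mean 1/a of n_k yields
    [mean_nodes_at_passage]; the closed formula is a rearrangement of the
    partial sums of the Poisson weights ([sum_poisson_cdf]). *)

(** * Joint laws and sums of independent variables *)

Section ProductLaw.
Context {d d1 d2 : measure_display} {T : measurableType d}
  {T1 : measurableType d1} {T2 : measurableType d2} {R : realType}.
Variable P : probability T R.
Local Open Scope ereal_scope.

(** Rectangles generate the product sigma-algebra, so that it is enough to know
    the joint law on them.  The extra event [F] is carried along because the
    conclusion then also says that every event of the pair is independent of
    [F]. *)
Lemma joint_law_indep (X : {mfun T >-> T1}) (Y : {mfun T >-> T2}) (F : set T) :
  measurable F ->
  (forall A B, measurable A -> measurable B ->
     P (X @^-1` A `&` Y @^-1` B `&` F) = P (X @^-1` A) * P (Y @^-1` B) * P F) ->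
  forall C : set (T1 * T2), measurable C ->
  P ((fun x => (X x, Y x)) @^-1` C `&` F)
    = P F * (distribution P X \x distribution P Y) C.
Proof.
move=> mF XYF.
have mXY : measurable_fun [set: T] (fun x => (X x, Y x)).
  exact: measurable_fun_pair.
pose XY x := (X x, Y x).
have [m1 m1E] : exists m1 : {measure set (T1 * T2) -> \bar R},
    forall C, m1 C = P (XY @^-1` C `&` F).
  pose m : {measure set (T1 * T2) -> \bar R} := pushforward (mrestr P mF) XY.
  by exists (m mXY).
have PF0 : (0 <= fine (P F))%R by rewrite fine_ge0.
pose m2 : {measure set (T1 * T2) -> \bar R} :=
  mscale (NngNum PF0) (distribution P X \x distribution P Y).
move=> C mC; rewrite -[LHS]m1E.
have -> : P F * (distribution P X \x distribution P Y) C = m2 C.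
  by rewrite /m2 /= /mscale /= fineK// fin_num_measure.
pose G : set (set (T1 * T2)) :=
  [set A `*` B | A in measurable & B in measurable].
apply: (measure_unique G (fun=> setT)) => //.
- by rewrite measurable_prod_measurableType.
- move=> _ _ [A mA [B mB <-]] [A' mA' [B' mB' <-]]; rewrite -setXI.
  by exists (A `&` A'); [exact: measurableI|exists (B `&` B') => //; exact: measurableI].
- by move=> _; exists setT => //; exists setT => //; rewrite setXTT.
- by rewrite bigcup_const.
- move=> _ [A mA [B mB <-]].
  rewrite m1E /m2 /= /mscale /= product_measure1E//.
  rewrite fineK ?fin_num_measure// /distribution /pushforward.
  by rewrite muleC -XYF.
- move=> _; rewrite m1E.
  by rewrite /= preimage_setT setTI ltey_eq fin_num_measure.
Qed.

Lemma expectation_indepM (X : {mfun T >-> T1}) (Y : {mfun T >-> T2})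
    (f : T1 -> \bar R) (g : T2 -> \bar R) :
  measurable_fun setT f -> measurable_fun setT g ->
  (forall x, 0 <= f x) -> (forall y, 0 <= g y) ->
  (forall A B, measurable A -> measurable B ->
     P (X @^-1` A `&` Y @^-1` B) = P (X @^-1` A) * P (Y @^-1` B)) ->
  \int[P]_x (f (X x) * g (Y x)) = \int[P]_x f (X x) * \int[P]_x g (Y x).
Proof.
move=> mf mg f0 g0 XY.
have mXY : measurable_fun [set: T] (fun x => (X x, Y x)).
  exact: measurable_fun_pair.
pose Z : {mfun T >-> (T1 * T2)%type} := mfun_Sub (mem_set mXY).
have mfg : measurable_fun [set: T1 * T2] (fun z => f z.1 * g z.2).
  by apply: emeasurable_funM; apply: measurableT_comp.
transitivity (\int[distribution P Z]_z (f z.1 * g z.2)).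
  by rewrite ge0_integral_distribution// => z; rewrite mule_ge0.
transitivity (\int[distribution P X \x distribution P Y]_z (f z.1 * g z.2)).
  apply: eq_measure_integral => C mC _.
  have := @joint_law_indep X Y setT measurableT _ C mC.
  rewrite setIT probability_setT mul1e => H; apply: H => // A B mA mB.
  by rewrite setIT mule1 XY.
rewrite fubini_tonelli1//=; last by move=> z; rewrite mule_ge0.
rewrite /fubini_F /=.
under eq_integral do rewrite ge0_integralZl//.
rewrite ge0_integralZr//; last exact: integral_ge0.
by rewrite !ge0_integral_distribution.
Qed.
End ProductLaw.

Section SumIndep.
Context {d : measure_display} {T : measurableType d} {R : realType}.
Variable P : probability T R.
Context {I : choiceType}.
Local Open Scope ereal_scope.

Lemma indep_rvs_prod {d' : measure_display} {S : measurableType d'}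
    (X : I -> T -> S) : indep_rvs P X ->
  forall (J : {fset I}) (B : I -> set S), (forall i, measurable (B i)) ->
  P (\bigcap_(i in [set` J]) X i @^-1` B i) = \prod_(i <- J) P (X i @^-1` B i).
Proof. by move=> iX J B mB; apply: iX => i _; exists (B i) => //; rewrite setTI. Qed.

Variable X : I -> {mfun T >-> R}.
Hypothesis indepX : indep_rvs P (X : I -> T -> R).

Let S (s : seq I) (x : T) : R := (\sum_(i <- s) X i x)%R.

Let mS s : measurable_fun setT (S s).
Proof. by apply: measurable_sum => i. Qed.

(** The event on the variables outside of [s] is what makes the induction on
    [s] go through: the head of the list joins these variables, and
    [joint_law_indep] is applied to the head and the sum of the tail. *)
Lemma indep_sum_others (s : seq I) : uniq s ->
  forall (J : {fset I}), (forall i, i \in s -> i \notin J) ->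
  forall (A : set R) (B : I -> set R), measurable A ->
    (forall i, measurable (B i)) ->
  P (S s @^-1` A `&` \bigcap_(i in [set` J]) X i @^-1` B i)
    = P (S s @^-1` A) * \prod_(i <- J) P (X i @^-1` B i).
Proof.
elim: s => [_|i s IHs /= /andP[si us]] J sJ A B mA mB.
  have -> : S [::] @^-1` A = if 0%R \in A then setT else set0.
    apply/seteqP; split=> x; rewrite /S/= big_nil.
      by move=> A0; rewrite mem_set.
    by case: ifPn => // /set_mem.
  case: ifPn => _; last by rewrite set0I measure0 mul0e.
  by rewrite setTI probability_setT mul1e (indep_rvs_prod indepX).
have mF : measurable (\bigcap_(j in [set` J]) X j @^-1` B j).
  apply: fin_bigcap_measurable => // j _.
  by rewrite -[X in measurable X]setTI; exact: measurable_funPT.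
pose Y : {mfun T >-> R} := mfun_Sub (mem_set (mS s)).
have fact (K : {fset I}) (B' : I -> set R) : (forall j, measurable (B' j)) ->
    (forall j, j \in i :: s -> j \notin K) ->
    forall A1 A2, measurable A1 -> measurable A2 ->
    P (X i @^-1` A1 `&` Y @^-1` A2 `&` \bigcap_(j in [set` K]) X j @^-1` B' j)
    = P (X i @^-1` A1) * P (Y @^-1` A2) * \prod_(j <- K) P (X j @^-1` B' j).
  move=> mB' sK A1 A2 mA1 mA2.
  pose B2 j := if j == i then A1 else B' j.
  have iK : i \notin K by apply: sK; rewrite mem_head.
  have -> : X i @^-1` A1 `&` Y @^-1` A2 `&`
      \bigcap_(j in [set` K]) X j @^-1` B' j =
      Y @^-1` A2 `&` \bigcap_(j in [set` i |` K]%fset) X j @^-1` B2 j.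
    apply/seteqP; split=> x.
      move=> [[XA YA] XK]; split => // j /=; rewrite !inE => /orP[/eqP->|jK].
        by rewrite /B2 eqxx.
      rewrite /B2; case: eqP => [ji|_]; first by rewrite -ji jK in iK.
      exact: XK.
    move=> [YA XK]; split; first split => //.
      by have := XK i; rewrite /B2 eqxx; apply => /=; rewrite !inE eqxx.
    move=> j jK; have := XK j; rewrite /B2; case: eqP => [ji|_].
      by rewrite -ji (jK : is_true (j \in K)) in iK.
    by apply => /=; rewrite !inE (jK : is_true (j \in K)) orbT.
  rewrite IHs//.
  - rewrite big_fsetU1//= /B2 eqxx muleA [P (Y @^-1` _) * _]muleC.
    congr (_ * _); apply: eq_big_seq => j jK; case: eqP => // ji.
    by rewrite -ji jK in iK.
  - move=> j js; rewrite !inE negb_or sK ?inE ?js ?orbT// andbT.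
    by apply: contraNneq si => <-.
  - by move=> j; rewrite /B2; case: ifP.
have E x : S (i :: s) x = (X i x + Y x)%R by rewrite /S/= big_cons.
pose C := [set z : R * R | A (z.1 + z.2)%R].
have mC : measurable C.
  rewrite -[X in measurable X]setTI.
  have : measurable_fun [set: R * R] (fun z : R * R => (z.1 + z.2)%R).
    exact: measurable_funD.
  by move=> /(_ measurableT _ mA).
have SC : S (i :: s) @^-1` A = (fun x => (X i x, Y x)) @^-1` C.
  by apply/seteqP; split=> x /=; rewrite E.
rewrite SC (@joint_law_indep _ _ _ _ _ _ _ P _ _ _ mF _ _ mC); last first.
  by move=> A1 A2 mA1 mA2; rewrite fact// (indep_rvs_prod indepX).
have := @joint_law_indep _ _ _ _ _ _ _ P (X i) Y setT measurableT _ C mC.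
rewrite setIT probability_setT mul1e => ->.
  by rewrite muleC (indep_rvs_prod indepX).
move=> A1 A2 mA1 mA2; have := fact fset0 (fun=> setT) (fun=> measurableT) _ A1 A2.
rewrite big_seq_fset0 set_fset0 bigcap_set0 mule1; exact.
Qed.

Lemma indep_sum_one (s : seq I) i : uniq s -> i \notin s ->
  forall A B : set R, measurable A -> measurable B ->
  P (S s @^-1` A `&` X i @^-1` B) = P (S s @^-1` A) * P (X i @^-1` B).
Proof.
move=> us si A B mA mB.
have := @indep_sum_others s us [fset i]%fset _ A (fun=> B) mA (fun=> mB).
rewrite big_seq_fset1 set_fset1 bigcap_set1; apply => j js.
by rewrite inE; apply: contraNneq si => <-.
Qed.

End SumIndep.

(** * Almost sure comparison of measures and of integrals *)

Section AlmostSure.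
Context {d : measure_display} {T : measurableType d} {R : realType}.
Variable P : probability T R.
Local Open Scope ereal_scope.

Lemma le_measure_ae (A B : set T) : measurable A -> measurable B ->
  {ae P, forall x, A x -> B x} -> P A <= P B.
Proof.
move=> mA mB [N [mN PN NAB]].
apply: (@le_trans _ _ (P (B `|` N))); last first.
  by rewrite (le_trans (measureU2 _ _ _))//= PN adde0.
apply: le_measure; rewrite ?inE//; first exact: measurableU.
move=> x Ax; have [Nx|nNx] := pselect (N x); [by right|left].
by apply: contrapT => nBx; apply: nNx; apply: NAB => /= /(_ Ax).
Qed.

Lemma eq_measure_ae (A B : set T) : measurable A -> measurable B ->
  {ae P, forall x, A x <-> B x} -> P A = P B.
Proof.
move=> mA mB AB; apply/eqP; rewrite eq_le; apply/andP; split;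
  by apply: le_measure_ae => //; apply: filterS AB => x [].
Qed.

End AlmostSure.

Section IntegralAE.
Context {d : measure_display} {T : measurableType d} {R : realType}.
Variable P : probability T R.
Local Open Scope ereal_scope.

(** The integral of a nonnegative function is a supremum over the simple
    functions below it, hence monotone without any measurability. *)
Lemma ge0_le_integral_nonmeasurable (f g : T -> \bar R) :
  (forall x, 0 <= f x) -> (forall x, f x <= g x) ->
  \int[P]_x f x <= \int[P]_x g x.
Proof.
move=> f0 fg; have g0 x : 0 <= g x by exact: le_trans (fg x).
rewrite !ge0_integralTE//; apply: ge_ereal_sup => _ [h hf <-].
by apply: ereal_sup_ubound; exists h => // x; exact: le_trans (fg x).
Qed.

(** [f] is squeezed between the measurable functions obtained from [g] by
    putting 0, respectively +oo, on a null set.  This spares a proof that the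
    number of nodes lost at a random time is measurable. *)
Lemma ge0_integral_ae_nonmeasurable (f g : T -> \bar R) :
  measurable_fun setT g -> (forall x, 0 <= f x) -> (forall x, 0 <= g x) ->
  {ae P, forall x, f x = g x} -> \int[P]_x f x = \int[P]_x g x.
Proof.
move=> mg f0 g0 [N [mN PN fgN]].
have fg x : ~ N x -> f x = g x.
  by move=> nN; apply: contrapT => nfg; apply: nN; exact: fgN.
have modify (e : \bar R) : 0 <= e ->
    \int[P]_x (if x \in N then e else g x) = \int[P]_x g x.
  move=> e0; apply: ge0_ae_eq_integral => //.
  - apply: measurable_fun_ifT => //; apply: (measurable_fun_bool true).
    rewrite setTI (_ : _ @^-1` _ = N)//.
    by apply/seteqP; split=> x /= => [/set_mem|/mem_set].
  - by move=> x _; case: ifP.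
  - exists N; split=> // x /= H; apply: contrapT => nN; apply: H => _.
    by rewrite memNset.
apply/eqP; rewrite eq_le; apply/andP; split.
  rewrite -(modify +oo)//; apply: ge0_le_integral_nonmeasurable => // x.
  by case: ifPn => [_|/negP nN]; rewrite ?leey// fg// => /mem_set.
rewrite -(modify 0)//; apply: ge0_le_integral_nonmeasurable => // x.
  by case: ifP.
by case: ifPn => [_|/negP nN]; rewrite // fg// => /mem_set.
Qed.

End IntegralAE.

(** * Integration against a density *)

Section Density.
Context {d : measure_display} {T : measurableType d} {R : realType}.
Variables (mu nu : {measure set T -> \bar R}) (g : T -> R).
Hypotheses (mg : measurable_fun setT g) (g0 : forall x, 0 <= g x).
Hypothesis nuE :
  forall A, measurable A -> nu A = (\int[mu]_(x in A) (g x)%:E)%E.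
Local Open Scope ereal_scope.
Import HBNNSimple.

Let integral_density_indic A (c : R) : measurable A -> (0 <= c)%R ->
  c%:E * nu A = \int[mu]_x ((c * \1_A x)%:E * (g x)%:E).
Proof.
move=> mA c0; rewrite nuE// -ge0_integralZl//; last 2 first.
- exact/measurable_EFinP/measurable_funTS.
- by move=> x _; rewrite lee_fin.
rewrite [LHS]integral_mkcond; apply: eq_integral => x _.
by rewrite patchE indicE; case: ifPn => _; rewrite ?mulr1 ?mulr0 ?mul0e.
Qed.

Let integral_density_nnsfun (h : {nnsfun T >-> R}) :
  \int[nu]_x (h x)%:E = \int[mu]_x ((h x)%:E * (g x)%:E).
Proof.
under eq_integral do rewrite fimfunE -fsumEFin//.
rewrite ge0_integral_fsum//; last 2 first.
- by move=> r; exact/measurable_EFinP/measurableT_comp.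
- by move=> r x _; rewrite EFinM nnfun_muleindic_ge0.
under [RHS]eq_integral.
  move=> x _; rewrite fimfunE -fsumEFin// ge0_mule_fsuml; last first.
    by move=> r; rewrite EFinM nnfun_muleindic_ge0.
  over.
rewrite [RHS]ge0_integral_fsum//; last 2 first.
- move=> r; apply: emeasurable_funM; apply/measurable_EFinP => //.
  exact: measurableT_comp.
- by move=> r x _; apply: mule_ge0; [rewrite EFinM nnfun_muleindic_ge0|rewrite lee_fin].
apply: eq_fsbigr => r /set_mem[x _ <-].
rewrite -integral_density_indic//.
have -> : \int[nu]_y (h x * \1_(h @^-1` [set h x]) y)%:E =
    \int[nu]_y ((h x)%:E * (\1_(h @^-1` [set h x]) y)%:E) by [].
rewrite ge0_integralZl//; first by rewrite integral_indic// setIT.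
- by apply/measurable_EFinP.
- by rewrite lee_fin.
Qed.

(** True by assumption for indicators, then for simple functions by linearity
    and in general by monotone convergence. *)
Lemma ge0_integral_density (f : T -> \bar R) :
  measurable_fun setT f -> (forall x, 0 <= f x) ->
  \int[nu]_x f x = \int[mu]_x (f x * (g x)%:E).
Proof.
move=> mf f0; pose h := nnsfun_approx measurableT mf.
have hf x : (h n x)%:E @[n --> \oo] --> f x by apply: cvg_nnsfun_approx.
have nd x : {homo (fun n => (h n x)%:E) : n m / (n <= m)%N >-> n <= m}.
  by move=> n m nm; rewrite lee_fin; exact/lefP/nd_nnsfun_approx.
transitivity (lim (\int[nu]_x (h n x)%:E @[n --> \oo])).
  rewrite -monotone_convergence//=.
  - by apply: eq_integral => x _; apply/esym/cvg_lim.
  - by move=> n; exact/measurable_EFinP/measurable_funTS.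
  - by move=> n x _; rewrite lee_fin.
rewrite [X in lim (X @ _)](_ : _ = fun n => \int[mu]_x ((h n x)%:E * (g x)%:E)).
  rewrite -monotone_convergence//=.
  - apply: eq_integral => x _; apply/cvg_lim => //.
    exact: cvgeZr.
  - by move=> n; apply: emeasurable_funM; exact/measurable_EFinP.
  - by move=> n x _; rewrite mule_ge0// lee_fin.
  - by move=> x _ n m nm; rewrite lee_wpmul2r ?lee_fin//; exact: nd.
by apply/funext => n; exact: integral_density_nnsfun.
Qed.

End Density.

(** * Poisson weights and Erlang integrals *)

Section PoissonWeights.
Context {R : realType}.
Implicit Types (c u v : R) (j l : nat).
Notation leb := (@lebesgue_measure R).

(** For [v > 0] this is the Poisson mass function; unlike [poisson_pmf] it is
    continuous at [v = 0], which is the mean number of points before the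
    observation time 0. *)
Definition poisson_weight v j : R := v ^+ j / (j`!)%:R * expR (- v).

Definition poisson_cdf v j : R := \sum_(i < j) poisson_weight v i.

Lemma poisson_weight_ge0 v j : 0 <= v -> 0 <= poisson_weight v j.
Proof. by move=> v0; rewrite !mulr_ge0 ?invr_ge0 ?exprn_ge0 ?expR_ge0. Qed.

Lemma poisson_cdf0 j : poisson_cdf 0 j.+1 = 1.
Proof.
rewrite /poisson_cdf big_ord_recl big1 ?addr0.
  by rewrite /poisson_weight expr0 fact0 invr1 oppr0 expR0 !mulr1.
by move=> i _; rewrite /poisson_weight expr0n /= !mul0r.
Qed.

Lemma poisson_cdfS v j :
  poisson_cdf v j.+1 = poisson_cdf v j + poisson_weight v j.
Proof. by rewrite /poisson_cdf big_ord_recr. Qed.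

Lemma is_derive_expRN v : is_derive v 1 (fun x => expR (- x)) (- expR (- v)).
Proof.
have dexp : is_derive (- v) 1 expR (expR (- v)) by exact: is_derive_expR.
have dopp : is_derive v 1 (-%R : R -> R) (-1) by exact: is_deriveNid.
by have := @is_derive1_comp R expR -%R v _ _ dexp dopp; rewrite mulrN1.
Qed.

Lemma is_derive_poisson_weight0 v :
  is_derive v 1 (poisson_weight^~ 0%N) (- poisson_weight v 0).
Proof.
have E x : poisson_weight x 0 = expR (- x).
  by rewrite /poisson_weight expr0 fact0 invr1 mulr1 mul1r.
rewrite E (_ : poisson_weight^~ 0%N = fun x => expR (- x)); last exact/funext.
exact: is_derive_expRN.
Qed.

Lemma is_derive_poisson_weightS v j :
  is_derive v 1 (poisson_weight^~ j.+1)
    (poisson_weight v j - poisson_weight v j.+1).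
Proof.
have dE := is_derive_expRN v.
have dX := @is_deriveX R _ id j.+1 v 1 1 (is_derive_id _ _).
have := is_deriveZ (j.+1)`!%:R^-1 (is_deriveM dX dE).
rewrite /GRing.scale /= /GRing.scale /= exprfctE => dF.
have -> : poisson_weight^~ j.+1 =
    (j.+1)`!%:R^-1 \*: ((@GRing.exp R)^~ j.+1 * (fun x : R => expR (- x))).
  apply/funext => x; rewrite /poisson_weight.
  rewrite -[RHS]/((j.+1)`!%:R^-1 * (x ^+ j.+1 * expR (- x))).
  by rewrite mulrA [_^-1 * _]mulrC.
apply: (is_derive_eq dF).
rewrite /poisson_weight factS natrM exprS.
have j0 : j.+1%:R != 0 :> R by rewrite pnatr_eq0.
have jf0 : j`!%:R != 0 :> R by rewrite pnatr_eq0 -lt0n fact_gt0.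
move: (j.+1%:R : R) (j`!%:R : R) j0 jf0 => p q p0 q0.
by field; rewrite p0 q0.
Qed.

(** The derivative of each weight is the difference of two consecutive ones,
    and the sum telescopes. *)
Lemma is_derive_poisson_cdf v j :
  is_derive v 1 (poisson_cdf^~ j.+1) (- poisson_weight v j).
Proof.
elim: j => [|j IHj].
  have -> : poisson_cdf^~ 1%N = poisson_weight^~ 0%N.
    by apply/funext => x; rewrite /poisson_cdf big_ord_recl big_ord0 addr0.
  exact: is_derive_poisson_weight0.
have -> : poisson_cdf^~ j.+2 = poisson_cdf^~ j.+1 \+ poisson_weight^~ j.+1.
  by apply/funext => x; rewrite /poisson_cdf [LHS]big_ord_recr.
have dw := is_derive_poisson_weightS v j.
by apply: is_derive_eq; rewrite addrA addNr add0r.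
Qed.

Lemma is_derive_scalel (c u : R) : is_derive u 1 ( *%R c) c.
Proof.
have := is_deriveZ c (is_derive_id u (1 : R^o)).
by rewrite /GRing.scale /= mulr1.
Qed.

Lemma is_derive_poisson_cdf_scale c u j :
  is_derive u 1 (fun u => poisson_cdf (c * u) j.+1)
    (- (c * poisson_weight (c * u) j)).
Proof.
have := @is_derive1_comp R _ _ _ _ _ (is_derive_poisson_cdf (c * u) j)
  (is_derive_scalel c u).
by rewrite mulNr mulrC.
Qed.

Lemma is_derive_continuous (F f : R -> R) :
  (forall x : R, is_derive x 1 F (f x)) -> continuous F.
Proof.
move=> dF x; apply/differentiable_continuous/derivable1_diffP.
exact: (@ex_derive _ _ _ _ _ _ _ (dF x)).
Qed.

Lemma is_derive_derive1 (F f : R -> R) :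
  (forall x : R, is_derive x 1 F (f x)) -> F^`()%classic = f.
Proof.
move=> dF; apply/funext => x; rewrite derive1E.
exact: (@derive_val _ _ _ _ _ _ _ (dF x)).
Qed.

Lemma continuous_poisson_weight j : continuous (poisson_weight^~ j).
Proof.
case: j => [|j]; apply: is_derive_continuous => v.
  exact: is_derive_poisson_weight0.
exact: is_derive_poisson_weightS.
Qed.

Lemma continuous_poisson_cdf j : continuous (poisson_cdf^~ j).
Proof.
case: j => [|j]; last exact: (is_derive_continuous (is_derive_poisson_cdf^~ j)).
rewrite (_ : poisson_cdf^~ 0%N = fun=> 0); first exact: cst_continuous.
by apply/funext => v; rewrite /poisson_cdf big_ord0.
Qed.

Lemma poisson_weight_le v j : 0 < v -> poisson_weight v j <= j.+1%:R / v.
Proof.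
move=> v0; rewrite /poisson_weight ler_pdivlMr// expRN.
rewrite mulrAC -ler_pdivlMr ?invr_gt0 ?expR_gt0// invrK.
rewrite mulrAC ler_pdivrMr ?ltr0n ?fact_gt0// -exprSr.
have := expR_ge1Dxn j (ltW v0) => ev.
have : v ^+ j.+1 / j.+1`!%:R <= expR v by rewrite (le_trans _ ev)// lerDr.
rewrite ler_pdivrMr ?ltr0n ?fact_gt0// factS natrM => /le_trans; apply.
by rewrite mulrA [expR v * _]mulrC.
Qed.

Lemma cvg_poisson_weight j : poisson_weight v j @[v --> +oo] --> 0.
Proof.
apply: (@squeeze_cvgr _ _ _ _ (fun=> 0) (fun v => j.+1%:R / v)).
- near=> v; have v0 : 0 < v by near: v; apply: nbhs_pinfty_gt; rewrite num_real.
  by apply/andP; split; [apply/poisson_weight_ge0/ltW|exact: poisson_weight_le].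
- exact: cvg_cst.
- rewrite -[X in _ --> X](mulr0 j.+1%:R); apply: cvgM; first exact: cvg_cst.
  apply/(gtr0_cvgV0 (f := id)); last exact: cvg_id.
  by apply: nbhs_pinfty_gt; rewrite num_real.
Unshelve. all: by end_near. Qed.

Lemma cvg_poisson_cdf j : poisson_cdf v j @[v --> +oo] --> 0.
Proof.
elim: j => [|j IHj].
  rewrite (_ : poisson_cdf^~ 0%N = fun=> 0); first exact: cvg_cst.
  by apply/funext => v; rewrite /poisson_cdf big_ord0.
rewrite (_ : poisson_cdf^~ j.+1 = poisson_cdf^~ j \+ poisson_weight^~ j).
  by rewrite -[X in _ --> X](addr0 0); apply: cvgD => //; exact: cvg_poisson_weight.
by apply/funext => v; rewrite /poisson_cdf big_ord_recr.
Qed.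

Lemma integral_erlang_pdf c j : 0 < c ->
  (\int[leb]_(u in `[0%R, +oo[) (c * poisson_weight (c * u) j)%:E = 1)%E.
Proof.
move=> c0.
have dF u : is_derive u 1 (fun u => - poisson_cdf (c * u) j.+1)
    (c * poisson_weight (c * u) j).
  by have := is_deriveN (is_derive_poisson_cdf_scale c u j); rewrite opprK.
have cf : continuous (fun u : R => c * poisson_weight (c * u) j).
  move=> u; apply: cvgM; first exact: cvg_cst.
  apply: (@continuous_comp _ _ _ ( *%R c) (poisson_weight^~ j)).
    exact: mulrl_continuous.
  exact: continuous_poisson_weight.
rewrite (@ge0_continuous_FTC2y _ _ (fun u => - poisson_cdf (c * u) j.+1) _ 0).
- by rewrite mulr0 poisson_cdf0 -EFinB opprK add0r.
- by move=> u u0; apply/mulr_ge0/poisson_weight_ge0/mulr_ge0; rewrite // ltW.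
- exact: continuous_subspaceT.
- rewrite -oppr0; apply: cvgN.
  apply: (@cvg_comp _ _ _ ( *%R c) (poisson_cdf^~ j.+1) _ +oo); last first.
    exact: cvg_poisson_cdf.
  exact: gt0_cvgMry.
- by move=> u _; exact: (@ex_derive _ _ _ _ _ _ _ (dF u)).
- by apply: cvg_at_right_filter; exact: (is_derive_continuous dF).
- by move=> u _; rewrite (is_derive_derive1 dF).
Qed.

(** Adding one exponential variable of rate [c] to an Erlang variable with [j]
    stages: [u |-> (poisson_cdf (c * (v - u)) j.+1 - 1) * expR (- (c * u))] is an
    antiderivative of the integrand on [0, v]. *)
Lemma integral_erlang_convolution c v j : 0 < c -> 0 < v ->
  (\int[leb]_(u in `[0%R, +oo[)
     ((if u < v then 1 - poisson_cdf (c * (v - u)) j else 0)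
        * (c * expR (- (c * u))))%:E
   = (1 - poisson_cdf (c * v) j.+1)%:E)%E.
Proof.
move=> c0 v0.
pose f u := (1 - poisson_cdf (c * (v - u)) j) * (c * expR (- (c * u))).
pose F u := (poisson_cdf (c * (v - u)) j.+1 - 1) * expR (- (c * u)).
have dsub (x : R) : is_derive x 1 (fun u : R => v - u) (-1).
  have := is_deriveD (is_derive_cst v x 1) (is_deriveNid x (1 : R^o)).
  by rewrite add0r.
have dexp (x : R) :
    is_derive x 1 (fun u => expR (- (c * u))) (- expR (- (c * x)) * c).
  exact: (@is_derive1_comp R (fun u => expR (- u)) ( *%R c) _ _ _
    (is_derive_expRN (c * x)) (is_derive_scalel c x)).
have dF u : is_derive u 1 F (f u).
  have d1 := @is_derive1_comp R (fun u => poisson_cdf (c * u) j.+1)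
    (fun u => v - u) _ _ _ (is_derive_poisson_cdf_scale c (v - u) j) (dsub u).
  have d2 := is_deriveM (is_deriveB d1 (is_derive_cst (1 : R) u 1)) (dexp u).
  apply: (is_derive_eq d2).
  rewrite -[LHS]/((poisson_cdf (c * (v - u)) j.+1 - 1)
      * (- expR (- (c * u)) * c) + expR (- (c * u))
      * (- (c * poisson_weight (c * (v - u)) j) * -1 - 0)).
  rewrite /f poisson_cdfS; ring.
have cf : continuous f.
  move=> u; apply: cvgM; last first.
    by apply: cvgM; [exact: cvg_cst|exact: (is_derive_continuous dexp)].
  apply: cvgB; first exact: cvg_cst.
  apply: (@continuous_comp _ _ _ (fun u => c * (v - u)) (poisson_cdf^~ j)).
    by apply: cvgM; [exact: cvg_cst|exact: (is_derive_continuous dsub)].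
  exact: continuous_poisson_cdf.
have mf : measurable_fun setT (EFin \o f).
  by apply: measurableT_comp => //; exact: continuous_measurable_fun.
transitivity (\int[leb]_(u in `[0%R, v[) (f u)%:E)%E.
  rewrite [LHS]integral_mkcond [RHS]integral_mkcond; apply: eq_integral => u _.
  rewrite !patchE /= !mem_setE !in_itv /= andbT.
  by case: ifP => //= _; case: ifP => // _; rewrite mul0r.
rewrite integral_itv_bndo_bndc; last exact: measurable_funTS.
rewrite (@continuous_FTC2 _ f F)//.
- rewrite /F subrr mulr0 subr0 poisson_cdf0 subrr mul0r oppr0 expR0 mulr1.
  by rewrite -EFinB sub0r opprB.
- exact: continuous_subspaceT.
- split.
  + by move=> u _; exact: (@ex_derive _ _ _ _ _ _ _ (dF u)).
  + by apply: cvg_at_right_filter; exact: (is_derive_continuous dF).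
  + by apply: cvg_at_left_filter; exact: (is_derive_continuous dF).
- by move=> u _; rewrite (is_derive_derive1 dF).
Qed.

End PoissonWeights.

Section PoissonCdf.
Context {R : realType}.
Implicit Types v : R.

Lemma cvg_poisson_cdf1 v : poisson_cdf v j @[j --> \oo] --> (1 : R).
Proof.
rewrite (_ : poisson_cdf v = fun j => series (exp_coeff v) j * expR (- v)).
  rewrite -(mulfV (lt0r_neq0 (expR_gt0 v))) -expRN.
  by apply: cvgM; [exact: is_cvg_series_exp_coeff|exact: cvg_cst].
apply/funext => j; rewrite /poisson_cdf /series /= big_mkord mulr_suml.
by apply: eq_bigr => i _.
Qed.

Lemma poisson_cdf_le1 v j : 0 <= v -> poisson_cdf v j <= 1.
Proof.
move=> v0.
have nd : nondecreasing_seq (poisson_cdf v).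
  apply/nondecreasing_seqP => i; rewrite poisson_cdfS lerDl.
  exact: poisson_weight_ge0.
have cv := cvg_poisson_cdf1 v.
have := nondecreasing_cvgn_le nd _ j; rewrite (cvg_lim _ cv)//; apply.
exact: cv.
Qed.

Lemma measurable_poisson_weight j :
  measurable_fun setT (fun v : R => poisson_weight v j).
Proof. exact: (continuous_measurable_fun (@continuous_poisson_weight R j)). Qed.

Lemma measurable_poisson_cdf j :
  measurable_fun setT (fun v : R => poisson_cdf v j).
Proof. exact: (continuous_measurable_fun (@continuous_poisson_cdf R j)). Qed.

End PoissonCdf.

(** * Exponential variables *)

Section ExponentialVariables.
Context {d : measure_display} {T : measurableType d} {R : realType}.
Variable P : probability T R.
Local Open Scope ereal_scope.

Lemma expectation_exponential (c : R) (X : {mfun T >-> R}) (f : R -> \bar R) :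
  (0 < c)%R -> exponential_rv P c X ->
  measurable_fun setT f -> (forall u, 0 <= f u) ->
  \int[P]_x f (X x)
    = \int[@lebesgue_measure R]_(u in `[0%R, +oo[)
        (f u * (c * expR (- (c * u)))%:E).
Proof.
move=> c0 Xc mf f0.
have mX : @measurable_fun _ _ T (measurableTypeR R) setT X.
  exact: (measurable_funPT X).
pose X' : {mfun T >-> measurableTypeR R} :=
  @mfun_Sub _ _ T (measurableTypeR R) X (mem_set mX).
transitivity (\int[distribution P X']_y f y).
  by rewrite ge0_integral_distribution.
rewrite (@ge0_integral_density _ (measurableTypeR R) R (@lebesgue_measure R)
  (distribution P X') (exponential_pdf c))//.
- rewrite [RHS]integral_mkcond; apply: eq_integral => u _.
  rewrite patchE mem_setE in_itv /= andbT.
  case: ifPn => u0; first by rewrite exponential_pdfE// mulNr.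
  by rewrite lt0_exponential_pdf ?mule0// ltNge.
- exact: measurable_exponential_pdf.
- by move=> u; rewrite exponential_pdf_ge0// ltW.
Qed.

(** The number of points of a Poisson process of rate [l] in an exponential time
    of rate [c] is geometric: the integrand times the exponential density is a
    multiple of an Erlang density of rate [l + c].  The maximum with 0 only makes
    the integrand nonnegative everywhere. *)
Lemma expectation_poisson_exponential (l c : R) (X : {mfun T >-> R}) j :
  (0 < l)%R -> (0 < c)%R -> exponential_rv P c X ->
  \int[P]_x (poisson_weight (l * Num.max 0 (X x)) j)%:E
    = (c / (l + c) * (l / (l + c)) ^+ j)%:E.
Proof.
move=> l0 c0 Xc.
have lc0 : (0 < l + c)%R by rewrite addr_gt0.
rewrite (expectation_exponential (f := fun u =>
    (poisson_weight (l * Num.max 0 u) j)%:E) c0 Xc); last 2 first.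
- apply/measurable_EFinP.
  apply: (@measurableT_comp _ _ _ _ _ _ (fun v : R => poisson_weight v j)).
    exact: (continuous_measurable_fun (@continuous_poisson_weight R j)).
  by apply: measurable_funM => //; exact: measurable_maxr.
- by move=> u; rewrite lee_fin poisson_weight_ge0// mulr_ge0 ?(ltW l0)// le_max lexx.
rewrite -[RHS]mule1 -(integral_erlang_pdf j lc0).
have q0 : (0 <= c / (l + c) * (l / (l + c)) ^+ j)%R.
  by rewrite mulr_ge0 ?exprn_ge0 ?divr_ge0// ltW.
rewrite -ge0_integralZl//; last 2 first.
- apply/measurable_EFinP/measurable_funTS/measurable_funM => //.
  apply: (@measurableT_comp _ _ _ _ _ _ (fun v : R => poisson_weight v j)).
    exact: (continuous_measurable_fun (@continuous_poisson_weight R j)).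
  exact: measurable_funM.
- move=> u; rewrite /= in_itv /= andbT => u0.
  by rewrite lee_fin mulr_ge0 ?poisson_weight_ge0 ?mulr_ge0// ltW.
apply: eq_integral => u; rewrite inE /= in_itv /= andbT => u0.
rewrite max_r// -!EFinM; congr EFin.
rewrite /poisson_weight [in RHS](mulrDl l c u) opprD expRD -mulrDl !exprMn.
have jf0 : (j`!%:R != 0 :> R)%R by rewrite pnatr_eq0 -lt0n fact_gt0.
have lcn : ((l + c) ^+ j != 0)%R by rewrite expf_neq0// gt_eqF.
have lcn1 : (l + c != 0)%R by rewrite gt_eqF.
rewrite exprVn; move: (l + c)%R ((l + c) ^+ j)%R lcn lcn1 => s sj sj0 s0.
by field; rewrite s0 sj0 jf0.
Qed.

(** Strict inequality makes the empty sum fit the formula: it lies below [v]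
    exactly for [v > 0], where [poisson_cdf _ 0 = 0]. *)
Lemma sum_exponential_cdf {I : choiceType} (c : R) (X : I -> {mfun T >-> R}) :
  (0 < c)%R -> indep_rvs P (X : I -> T -> R) ->
  (forall i, exponential_rv P c (X i)) ->
  forall (s : seq I) (v : R), uniq s ->
  P [set x | \sum_(i <- s) X i x < v]%R
    = (if 0 < v then 1 - poisson_cdf (c * v) (size s) else 0)%R%:E.
Proof.
move=> c0 iX Xc; elim=> [|i s IHs] v /=.
  move=> _; rewrite /poisson_cdf big_ord0 subr0.
  rewrite (_ : [set x | _] = if (0 < v)%R then setT else set0).
    by case: ifP => _; rewrite ?probability_setT ?measure0.
  apply/seteqP; split=> x /=; rewrite big_nil; first by move=> ->.
  by case: ifP.
move=> /andP[si us].
have mS : measurable_fun setT (fun x => \sum_(j <- s) X j x)%R.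
  exact: measurable_sum.
pose S : {mfun T >-> R} := mfun_Sub (mem_set mS).
pose C := [set z : R * R | z.1 + z.2 < v]%R.
have mC : measurable C.
  rewrite (_ : C = setT `&` (fun z : R * R => z.1 + z.2)%R @^-1` `]-oo, v[).
    have : measurable_fun setT (fun z : R * R => z.1 + z.2)%R.
      exact: measurable_funD.
    by apply=> //; exact: measurable_itv.
  by apply/seteqP; split=> z; rewrite /C /= in_itv //= => -[].
have -> : [set x | \sum_(j <- i :: s) X j x < v]%R
    = (fun x => (X i x, S x)) @^-1` C.
  by apply/seteqP; split=> x /=; rewrite big_cons.
have := @joint_law_indep _ _ _ _ _ _ _ P (X i) S setT measurableT _ C mC.
rewrite setIT probability_setT mul1e => ->; last first.
  move=> A B mA mB; rewrite setIT mule1 setIC muleC.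
  exact: (indep_sum_one iX us si).
pose G (u : R) : R := if (0 < u)%R then (1 - poisson_cdf (c * u) (size s))%R else 0%R.
have PG u : distribution P S (xsection C u) = (G (v - u)%R)%:E.
  rewrite /G -IHs// /distribution /pushforward; congr (P _).
  apply/seteqP; split=> x /=; rewrite /xsection /= inE /C /=;
    by rewrite ltrBrDl.
have mG : measurable_fun setT (fun u : R => (G (v - u)%R)%:E).
  rewrite (_ : (fun u => _) = distribution P S \o xsection C).
    exact: measurable_fun_xsection.
  by apply/funext => u; rewrite /= PG.
have G0 u : 0 <= (G u)%:E.
  by have := PG (v - u)%R; rewrite subKr => <-.
transitivity (\int[P]_x (G (v - X i x)%R)%:E).
  rewrite -(@ge0_integral_distribution _ _ _ _ _ P (X i)
    (fun u : R => (G (v - u)%R)%:E))//.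
  by rewrite /product_measure1; apply: eq_integral => u _; exact: PG.
rewrite (expectation_exponential (f := fun u : R => (G (v - u)%R)%:E) c0)//.
case: ifPn => v0.
  rewrite -integral_erlang_convolution//.
  by apply: eq_integral => u _; rewrite -EFinM /G subr_gt0.
rewrite integral0_eq// => u; rewrite /= in_itv /= andbT => u0.
rewrite /G subr_gt0 ifF ?mul0e//; apply/negbTE; rewrite -leNgt.
by rewrite -leNgt in v0; exact: le_trans v0 u0.
Qed.

Lemma exponential_rv_gt0 (c : R) (X : {mfun T >-> R}) :
  exponential_rv P c X -> {ae P, forall x, 0 < X x}%R.
Proof.
move=> Xc; exists (X @^-1` `]-oo, 0%R]); split.
- by rewrite -[X in measurable X]setTI; exact: measurable_funPT.
- have -> : P (X @^-1` `]-oo, 0%R]) = exponential_prob c `]-oo, 0%R].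
    by rewrite Xc.
  rewrite /exponential_prob -integral_itv_bndo_bndc.
    rewrite integral0_eq// => u; rewrite /= in_itv /= => u0.
    by rewrite lt0_exponential_pdf.
  apply: measurable_funTS; apply: measurableT_comp => //.
  exact: measurable_exponential_pdf.
- by move=> x /=; rewrite in_itv /= => /negP; rewrite -leNgt.
Qed.

End ExponentialVariables.

(** * Generated sigma-algebras *)

Section SigmaFamily.
Context {d d' : measure_display} {T : measurableType d} {S : measurableType d'}.
Context {I : Type} (X : I -> T -> S).

Definition generators := \bigcup_i preimage_set_system setT (X i) measurable.

Lemma sigma_family_measurable_fun i :
  @measurable_fun _ _ (g_sigma_algebraType generators) S setT (X i).
Proof.
move=> _ A mA; apply: sub_sigma_algebra; exists i => //.
by exists A.
Qed.

Lemma sigma_family_preimage {d2} {S2 : measurableType d2} (Y : T -> S2) A :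
  @measurable_fun _ _ (g_sigma_algebraType generators) S2 setT Y ->
  measurable A -> sigma_family X (Y @^-1` A).
Proof. by move=> mY mA; have := mY measurableT A mA; rewrite setTI. Qed.

Lemma sigma_family_bigcap (J : {fset nat}) (f : nat -> I) (B : nat -> set S) :
  (forall i, measurable (B i)) ->
  sigma_family X (\bigcap_(i in [set` J]) X (f i) @^-1` B i).
Proof.
move=> mB.
have := @fin_bigcap_measurable _ (g_sigma_algebraType generators) _ [set` J]
  (fun i => X (f i) @^-1` B i); apply=> // i _.
by apply: (sigma_family_preimage _ (mB i)); exact: sigma_family_measurable_fun.
Qed.

Lemma sigma_family_sub : (forall i, measurable_fun setT (X i)) ->
  sigma_family X `<=` measurable.
Proof.
move=> mX; apply: smallest_sub; first exact: sigma_algebra_measurable.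
by move=> _ [i _ [A mA <-]]; exact: mX.
Qed.

End SigmaFamily.

Section CountPartition.
Context {d : measure_display} {T : measurableType d} {R : realType}.
Variables (P : probability T R) (Y : T -> nat) (E : set T) (m : nat).
Hypothesis mEY : forall j, (j < m)%N -> measurable (E `&` Y @^-1` [set j]).
Hypothesis Y_lt : forall x, E x -> (Y x < m)%N.

Let count_splitE : E = \bigcup_(j < m) (E `&` Y @^-1` [set j]).
Proof.
apply/seteqP; split=> x; last by move=> [j _ []].
by move=> Ex; exists (Y x) => //=; exact: Y_lt.
Qed.

Lemma measurable_count_split : measurable E.
Proof.
by rewrite count_splitE; apply: fin_bigcup_measurable => // j /=; exact: mEY.
Qed.

Lemma measure_count_split :
  P E = (\sum_(j < m) P (E `&` Y @^-1` [set (j : nat)]))%E.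
Proof.
rewrite -(@measure_bigsetU_ord _ _ _ P m xpredT
  (fun j : 'I_m => E `&` Y @^-1` [set (j : nat)])); last 2 first.
- by move=> j; exact: mEY.
- by apply/trivIsetP => i j _ _ ij; rewrite setIACA setIid -preimage_setI;
    apply/seteqP; split=> x //= -[_ []] -> /val_inj ji; rewrite ji eqxx in ij.
by rewrite -(bigcup_mkord m (fun j => E `&` Y @^-1` [set j])) -count_splitE.
Qed.

End CountPartition.

(** * Geometric variables and their renewals *)

Section Geometric.
Context {d : measure_display} {T : measurableType d} {R : realType}.
Variables (P : probability T R) (a : R) (n : {mfun T >-> nat}).
Hypotheses (a_gt0 : 0 < a) (a_lt1 : a < 1) (n_law : geometric_rv P a n).

Definition geometric_pmf (j : nat) : R := if j is i.+1 then a * (1 - a) ^+ i else 0.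

Let mn (A : set nat) : measurable (n @^-1` A).
Proof. by rewrite -[X in measurable X]setTI; exact: measurable_funPT. Qed.

Lemma sum_geometric_pmf m : \sum_(j < m.+1) geometric_pmf j = 1 - (1 - a) ^+ m.
Proof.
elim: m => [|m IHm]; first by rewrite big_ord1 expr0 subrr.
by rewrite big_ord_recr IHm /= exprS; ring.
Qed.

Let prob_le m :
  P [set x | (n x <= m)%N] = (P (n @^-1` [set 0%N]) + (1 - (1 - a) ^+ m)%:E)%E.
Proof.
rewrite (@measure_count_split _ _ _ P n _ m.+1)//; last first.
  by move=> j _; exact: (mn ([set i | (i <= m)%N] `&` [set j])).
have E j : (j <= m)%N ->
    [set x | (n x <= m)%N] `&` n @^-1` [set j] = n @^-1` [set j].
  by move=> jm; apply/seteqP; split=> [x []//|x /= nx]; rewrite nx.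
rewrite big_ord_recl E//; congr (_ + _)%E.
rewrite -sum_geometric_pmf big_ord_recl add0r -sumEFin; apply: eq_bigr => i _.
by rewrite E ?(ltn_ord i)//= n_law.
Qed.

(** The law prescribes no mass at 0, but the masses at the positive integers
    already add up to 1. *)
Lemma geometric_rv0 : P (n @^-1` [set 0%N]) = 0%E.
Proof.
apply/eqP; rewrite eq_le measure_ge0 andbT.
apply/lee_addgt0Pr => e e0; rewrite add0e.
have b0 : 0 <= 1 - a by rewrite subr_ge0 ltW.
have cv : (1 - a) ^+ m @[m --> \oo] --> 0.
  by apply: cvg_expr; rewrite ger0_norm// ltrBlDr ltrDl.
have [m _ /(_ m (leqnn m))] := (cvgrPdist_le _ _).1 cv e e0.
rewrite sub0r normrN ger0_norm ?exprn_ge0// => bme.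
have := probability_le1 P (mn [set i | (i <= m)%N]).
rewrite (_ : _ @^-1` _ = [set x | (n x <= m)%N])// prob_le => p1.
apply: (@le_trans _ _ ((1 - a) ^+ m)%:E); last by rewrite lee_fin.
rewrite -(@leeD2rE _ (1 - (1 - a) ^+ m)%:E)// (le_trans p1)//.
by rewrite -EFinD lee_fin addrC subrK.
Qed.

Lemma geometric_rv_pmf j : P (n @^-1` [set j]) = (geometric_pmf j)%:E.
Proof. by case: j => [|j]; [exact: geometric_rv0|rewrite n_law]. Qed.

Lemma geometric_rv_tail j : P (n @^-1` [set i | (j < i)%N]) = ((1 - a) ^+ j)%:E.
Proof.
rewrite (_ : _ @^-1` _ = ~` [set x | (n x <= j)%N]); last first.
  by apply/seteqP; split=> x /=; rewrite ltnNge => /negP.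
rewrite probability_setC; last exact: (mn [set i | (i <= j)%N]).
by rewrite prob_le geometric_rv0 add0e -EFinB subKr.
Qed.

End Geometric.

Section GeometricRenewal.
Context {R : realType}.
Variable a : R.

(** The mass at [m] of a sum of [k] independent geometric variables, by
    conditioning on the last one. *)
Fixpoint geometric_sum_pmf (k m : nat) : R :=
  if k is k'.+1 then
    \sum_(j < m.+1) geometric_sum_pmf k' (m - j) * geometric_pmf a j
  else (m == 0)%:R.

Lemma geometric_pmf_ge0 j : 0 <= a -> a <= 1 -> 0 <= geometric_pmf a j.
Proof.
by case: j => // j a0 a1; rewrite mulr_ge0// exprn_ge0// subr_ge0.
Qed.

Lemma geometric_sum_pmf_ge0 k m : 0 <= a -> a <= 1 -> 0 <= geometric_sum_pmf k m.
Proof.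
move=> a0 a1; elim: k m => [|k IHk] m /=; first by rewrite ler0n.
by apply: sumr_ge0 => j _; rewrite mulr_ge0// geometric_pmf_ge0.
Qed.

Lemma geometric_sum_pmf_gt k m : (m < k)%N -> geometric_sum_pmf k m = 0.
Proof.
elim: k m => // k IHk m mk /=.
rewrite big_ord_recl mulr0 add0r big1// => j _.
rewrite lift0 IHk ?mul0r//.
by have := ltn_ord j; lia.
Qed.

(** A sum of [k] variables, each at least 1, is [m] only for [k <= m], so that
    the sum is the probability that the renewal process visits [m].  By induction
    on the position of the first jump, this is [a] for every [m >= 1]: the
    process behaves as the success times of independent trials. *)
Lemma geometric_renewal K m : (m < K)%N ->
  \sum_(k < K) geometric_sum_pmf k m = if m == 0%N then 1 else a.
Proof.
elim/ltn_ind: m K => m IHm [//|K] mK; rewrite big_ord_recl /=.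
under eq_bigr do rewrite add0n /=.
case: m IHm mK => [|m] IHm mK /=.
  rewrite big1 ?addr0// => i _.
  by rewrite big_ord1 mulr0.
rewrite add0r exchange_big /= big_ord_recl big1 ?add0r; last first.
  by move=> i _; rewrite mulr0.
transitivity (\sum_(i < m.+1) (if i == m :> nat then 1 else a) * (a * (1 - a) ^+ i)).
  apply: eq_bigr => i _ /=; rewrite -mulr_suml subSS IHm ?subSS//; last 2 first.
  - by rewrite ltnS leq_subr.
  - by rewrite (leq_ltn_trans (leq_subr _ _)).
  by have := ltn_ord i; rewrite ltnS add0n subn_eq0 eqn_leq => ->.
rewrite big_ord_recr /= eqxx mul1r.
transitivity (a * (1 - (1 - a) ^+ m) + a * (1 - a) ^+ m); last by ring.
congr (_ + _); rewrite -sum_geometric_pmf big_ord_recl add0r mulr_sumr.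
by apply: eq_bigr => i _; rewrite ltn_eqF.
Qed.

End GeometricRenewal.

(** * Losses in the first attacks *)

Section Losses.
Context {T : Type} {R : realType}.
Variables (n : nat -> T -> nat) (w : nat -> nat -> T -> R).

Definition nodes_after (k : nat) (x : T) : nat := (\sum_(i < k) n i x)%N.

Definition weight_after (k : nat) (x : T) : R :=
  \sum_(i < k) attack_weight n w i x.

Definition inside (M : nat) (V : R) (k : nat) : set T :=
  [set x | (nodes_after k x < M)%N /\ weight_after k x < V].

Definition crossing (M : nat) (V : R) (c : nat) : set T :=
  inside M V c `\` inside M V c.+1.

End Losses.

Section LossLaw.
Context {d : measure_display} {T : measurableType d} {R : realType}.
Variables (P : probability T R) (a xi V : R).
Variables (n : nat -> {mfun T >-> nat}) (w : nat -> nat -> {mfun T >-> R}).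
Variable F : set T.
Hypotheses (a_gt0 : 0 < a) (a_lt1 : a < 1) (xi_gt0 : 0 < xi) (V_gt0 : 0 < V).
Hypothesis n_law : forall k, geometric_rv P a (n k).
Hypothesis n_indep : indep_rvs P (fun k => n k : T -> nat).
Hypothesis w_law : forall k j, exponential_rv P xi (w k j).
Hypothesis w_indep :
  indep_rvs P (fun kj : nat * nat => w kj.1 kj.2 : T -> R).
Hypothesis mF : measurable F.
Hypothesis indepF : forall En Ew : set T,
  sigma_family (fun k => n k : T -> nat) En ->
  sigma_family (fun kj : nat * nat => w kj.1 kj.2 : T -> R) Ew ->
  P (En `&` Ew `&` F) = (P En * P Ew * P F)%E.

Let Nk := nodes_after (fun k => n k).
Let Wk := weight_after (fun k => n k) (fun k j => w k j).

(** The weights indexed by [s] and the constraints on the attacks of [J] stand for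
    what has been fixed about the attacks that come after the first [k]. *)
Let event k m (s : seq (nat * nat)) (J : {fset nat}) (B : nat -> set nat) :=
  [set x | Nk k x = m /\ Wk k x + \sum_(ij <- s) w ij.1 ij.2 x < V]
    `&` \bigcap_(i in [set` J]) n i @^-1` B i `&` F.

Let survival j : R := 1 - poisson_cdf (xi * V) j.

Let mn i (A : set nat) : measurable (n i @^-1` A).
Proof. by rewrite -[X in measurable X]setTI; exact: measurable_funPT. Qed.

Let event_split k m s J B j : k \notin J -> (j <= m)%N ->
  event k.+1 m s J B `&` n k @^-1` [set j] =
  event k (m - j) (s ++ [seq (k, i) | i <- iota 0 j]) (k |` J)%fset
    (fun i => if i == k then [set j] else B i).
Proof.
move=> kJ jm; rewrite /event.
have Nk1 x : Nk k.+1 x = (Nk k x + n k x)%N.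
  by rewrite /Nk /nodes_after big_ord_recr.
have Wk1 x : n k x = j -> Wk k.+1 x + \sum_(ij <- s) w ij.1 ij.2 x =
    Wk k x + \sum_(ij <- s ++ [seq (k, i) | i <- iota 0 j]) w ij.1 ij.2 x.
  move=> nk; rewrite /Wk /weight_after big_ord_recr /= big_cat /= big_map /=.
  rewrite -addrA [X in _ + X]addrC; congr (_ + (_ + _)).
  by rewrite /attack_weight nk -(big_mkord xpredT (fun i => w k i x)) /index_iota subn0.
apply/seteqP; split=> x.
  move=> [[[[Nx Wx] Jx] Fx] /= nk]; split=> //; split.
    by split; [rewrite -Nx Nk1 nk addnK|rewrite -Wk1].
  move=> i /=; rewrite !inE; case: eqP => [->//|_ /= iJ].
  exact: Jx.
move=> [[[Nx Wx] Jx] Fx].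
have nk : n k x = j by have := Jx k; rewrite /= eqxx; apply; rewrite !inE eqxx.
split=> //; split=> //; split.
  by split; [rewrite Nk1 Nx nk subnK|rewrite Wk1].
move=> i /= iJ; have := Jx i; rewrite /= !inE iJ orbT => /(_ isT).
by case: eqP => // ik; rewrite -ik iJ in kJ.
Qed.

(** Conditioning on the size [j] of attack [k] turns it into a constraint on one
    more attack and moves [j] individual weights into [s]; this removes the random
    number of weights from the picture.  After [k] steps, what is left is a product
    of events of the families [n] and [w]. *)
Let event_law k : forall m s J B, uniq s ->
    (forall ij, ij \in s -> (k <= ij.1)%N) ->
    (forall i, i \in J -> (k <= i)%N) ->
  measurable (event k m s J B) /\
  P (event k m s J B) =
    ((geometric_sum_pmf a k m * survival (m + size s))%:E
      * (\prod_(i <- J) P (n i @^-1` B i) * P F))%E.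
Proof.
elim: k => [|k IHk] m s J B us sk Jk.
  have mS : measurable_fun setT (fun x => \sum_(ij <- s) w ij.1 ij.2 x).
    exact: measurable_sum.
  have mJ : measurable (\bigcap_(i in [set` J]) n i @^-1` B i).
    by apply: fin_bigcap_measurable => // i _; exact: mn.
  have mW : measurable [set x | \sum_(ij <- s) w ij.1 ij.2 x < V].
    have := mS measurableT `]-oo, V[%classic (measurable_itv _); rewrite setTI.
    by rewrite (_ : _ @^-1` _ = [set x | \sum_(ij <- s) w ij.1 ij.2 x < V]).
  case: m => [|m]; last first.
    rewrite (_ : event _ _ _ _ _ = set0) /= ?mul0r ?mul0e ?measure0//.
    by apply/seteqP; split=> x // -[[[]]]; rewrite /Nk /nodes_after big_ord0.
  have -> : event 0 0 s J B = \bigcap_(i in [set` J]) n i @^-1` B i `&`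
      [set x | \sum_(ij <- s) w ij.1 ij.2 x < V] `&` F.
    rewrite [X in X `&` F]setIC; congr (_ `&` _ `&` _).
    apply/seteqP; split=> x /=;
      rewrite /Nk /Wk /nodes_after /weight_after !big_ord0 add0r //.
    by case.
  split; first by apply: measurableI => //; exact: measurableI.
  rewrite indepF; last 2 first.
  - have := @sigma_family_bigcap _ _ _ _ _ (fun k => n k : T -> nat) J id B.
    exact.
  - have mSw : @measurable_fun _ _ (g_sigma_algebraType (generators
        (fun kj : nat * nat => w kj.1 kj.2 : T -> R))) R setT
        (fun x => \sum_(ij <- s) w ij.1 ij.2 x).
      apply: measurable_sum => ij.
      exact: (@sigma_family_measurable_fun _ _ _ _ _
        (fun kj : nat * nat => w kj.1 kj.2 : T -> R) ij).
    have := sigma_family_preimage mSw (measurable_itv `]-oo, V[).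
    by rewrite (_ : _ @^-1` _ = [set x | \sum_(ij <- s) w ij.1 ij.2 x < V]).
  rewrite (indep_rvs_prod n_indep)//.
  rewrite (@sum_exponential_cdf _ _ _ P _ xi
    (fun kj : nat * nat => w kj.1 kj.2))// V_gt0.
  by rewrite /= mul1r add0n muleCA muleA.
have kJ : k \notin J by apply/negP => /Jk; rewrite ltnn.
pose Bj j i := if i == k then [set j] else B i.
have split_law (j : 'I_m.+1) :
    measurable (event k.+1 m s J B `&` n k @^-1` [set (j : nat)]) /\
    P (event k.+1 m s J B `&` n k @^-1` [set (j : nat)]) =
    ((geometric_sum_pmf a k (m - j) * geometric_pmf a j)%:E *
    ((survival (m + size s))%:E * (\prod_(i <- J) P (n i @^-1` B i) * P F)))%E.
  rewrite event_split// ?leq_ord//.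
  have [||| mE ->] := IHk (m - j)%N (s ++ [seq (k, i) | i <- iota 0 j])
      (k |` J)%fset (Bj j).
  - rewrite cat_uniq us map_inj_uniq ?iota_uniq ?andbT; last by move=> ? ? [].
    by apply/hasPn => _ /mapP[i _ ->]; apply/negP => /sk; rewrite ltnn.
  - move=> ij; rewrite mem_cat => /orP[/sk/ltnW//|/mapP[i _ ->]]; exact: leqnn.
  - by move=> i; rewrite !inE => /orP[/eqP->//|/Jk/ltnW].
  split=> //; rewrite big_fsetU1//= /Bj eqxx (geometric_rv_pmf a_gt0 a_lt1 (n_law k)).
  rewrite size_cat size_map size_iota.
  rewrite (_ : m - j + (size s + j) = m + size s)%N; last first.
    by have := ltn_ord j; lia.
  rewrite (eq_big_seq (fun i => P (n i @^-1` B i))); last first.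
    by move=> i iJ; case: eqP => // ik; rewrite -ik iJ in kJ.
  by rewrite !EFinM -!muleA; congr (_ * _)%E; rewrite [LHS]muleCA.
have nkm x : event k.+1 m s J B x -> (n k x < m.+1)%N.
  move=> [[[Nx _] _] _].
  by rewrite ltnS -Nx /Nk /nodes_after big_ord_recr leq_addl.
have mEk j : (j < m.+1)%N -> measurable (event k.+1 m s J B `&` n k @^-1` [set j]).
  by move=> jm; exact: (split_law (Ordinal jm)).1.
split; first exact: (measurable_count_split mEk nkm).
rewrite (measure_count_split P mEk nkm).
under eq_bigr do rewrite (split_law _).2.
rewrite -ge0_sume_distrl; last first.
  move=> j _; have a0 := ltW a_gt0; have a1 := ltW a_lt1.
  by rewrite lee_fin mulr_ge0 ?geometric_sum_pmf_ge0 ?geometric_pmf_ge0.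
by rewrite sumEFin EFinM -muleA.
Qed.

Definition inside_prob M k : R :=
  \sum_(m < M) geometric_sum_pmf a k m * survival m.

(** The constraint on the later attack [K] is kept so that the law of its size
    comes out as a factor, which is needed to weigh the attack by its nodes. *)
Let inside_event M k K (B : set nat) m : (m < M)%N ->
  inside (fun k => n k) (fun k j => w k j) M V k `&` n K @^-1` B `&` F
    `&` Nk k @^-1` [set m] = event k m [::] [fset K]%fset (fun=> B).
Proof.
move=> mM; rewrite /event set_fset1 bigcap_set1; apply/seteqP; split=> x /=.
  by move=> [[[[_ WV] nB] Fx] Nm]; rewrite big_nil addr0.
by rewrite big_nil addr0 => -[[[Nm WV] nB] Fx]; do 4 split => //; rewrite -/Nk Nm.
Qed.

Let inside_event_law M k K (B : set nat) m : (k <= K)%N -> (m < M)%N ->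
  let E := inside (fun k => n k) (fun k j => w k j) M V k `&` n K @^-1` B
    `&` F `&` Nk k @^-1` [set m] in
  measurable E /\
  P E = ((geometric_sum_pmf a k m * survival m)%:E * (P (n K @^-1` B) * P F))%E.
Proof.
move=> kK mM; rewrite /= inside_event//.
have := @event_law k m [::] [fset K]%fset (fun=> B).
rewrite big_seq_fset1 addn0; apply=> // i; rewrite inE => /eqP ->; exact: kK.
Qed.

Let inside_event_cut M k K (B : set nat) (kK : (k <= K)%N) m (mM : (m < M)%N) :=
  (inside_event_law B kK mM).1.

Lemma measurable_inside M k K (B : set nat) : (k <= K)%N ->
  measurable (inside (fun k => n k) (fun k j => w k j) M V k `&` n K @^-1` B `&` F).
Proof.
move=> kK; apply: (measurable_count_split (inside_event_cut B kK)).
by move=> x [[[]]].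
Qed.

Lemma inside_law M k K (B : set nat) : (k <= K)%N ->
  P (inside (fun k => n k) (fun k j => w k j) M V k `&` n K @^-1` B `&` F)
    = ((inside_prob M k)%:E * (P (n K @^-1` B) * P F))%E.
Proof.
move=> kK; rewrite (measure_count_split P (inside_event_cut B kK)); last first.
  by move=> x [[[]]].
rewrite /inside_prob -sumEFin muleC fin_num_sume_distrr//.
- by apply: eq_bigr => m _; rewrite (inside_event_law B kK (ltn_ord m)).2 muleC.
- by rewrite fin_numM// fin_num_measure.
Qed.

Let crossing_eventE M c K (B : set nat) :
  crossing (fun k => n k) (fun k j => w k j) M V c `&` n K @^-1` B `&` F
  = (inside (fun k => n k) (fun k j => w k j) M V c `&` n K @^-1` B `&` F)
    `\` (inside (fun k => n k) (fun k j => w k j) M V c.+1 `&` n K @^-1` B `&` F).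
Proof.
apply/seteqP; split=> x.
  by move=> [[[Dc nDc] nB] Fx]; split => // -[[]].
by move=> [[[Dc nB] Fx] nD]; do 3 split => //; move=> Dc'; apply: nD.
Qed.

Lemma measurable_crossing M c K (B : set nat) : (c < K)%N ->
  measurable (crossing (fun k => n k) (fun k j => w k j) M V c
    `&` n K @^-1` B `&` F).
Proof.
move=> cK; rewrite crossing_eventE.
by apply: measurableD; apply: measurable_inside => //; exact: ltnW.
Qed.

Lemma crossing_law M c K (B : set nat) : (c < K)%N ->
  P (crossing (fun k => n k) (fun k j => w k j) M V c `&` n K @^-1` B `&` F)
    = ((inside_prob M c - inside_prob M c.+1)%:E * (P (n K @^-1` B) * P F))%E.
Proof.
move=> cK; have mc := @measurable_inside M c K B (ltnW cK).
have mc1 := @measurable_inside M c.+1 K B cK.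
rewrite crossing_eventE measureD//; last by rewrite ltey_eq fin_num_measure.
transitivity (P (inside (fun k => n k) (fun k j => w k j) M V c
      `&` n K @^-1` B `&` F)
    - P (inside (fun k => n k) (fun k j => w k j) M V c.+1
      `&` n K @^-1` B `&` F))%E.
  congr (_ - _)%E; apply: eq_measure_ae => //; first exact: measurableI.
  have : {ae P, forall x, forall k j, 0 < w k j x}.
    apply: ae_foralln => k; apply: ae_foralln => j.
    exact: exponential_rv_gt0 (w_law k j).
  apply: filterS => x w_gt0; split=> [[]//|[[[Nx Wx] nB] Fx]].
  split=> //; do 2 split => //; split.
    by apply: leq_ltn_trans Nx; rewrite /nodes_after big_ord_recr leq_addr.
  apply: le_lt_trans Wx; rewrite /weight_after big_ord_recr lerDl.
  by apply: sumr_ge0 => j _; exact: ltW.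
rewrite !inside_law ?(ltnW cK)// EFinB muleBl ?fin_num_measure//.
  by rewrite fin_numM// fin_num_measure.
Qed.

End LossLaw.

(** * Two points of a Poisson process *)

Section PointCount.
Context {d : measure_display} {T : measurableType d} {R : realType}.
Implicit Types (t : nat -> T -> R) (x : T) (s u : R).
Local Open Scope ereal_scope.

Lemma eseries_finite (p : pred nat) (f : nat -> \bar R) m :
  (forall k, (m <= k)%N -> p k -> f k = 0) ->
  \sum_(0 <= k <oo | p k) f k = \sum_(0 <= k < m | p k) f k.
Proof.
move=> f0; apply/cvg_lim => //; apply: cvg_near_cst.
exists m => // l /= ml; rewrite (@big_cat_nat _ _ _ m)//=.
rewrite [X in _ + X]big_nat_cond [X in _ + X]big1 ?adde0// => k.
by move=> /andP[/andP[mk _] pk]; exact: f0.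
Qed.

(** A relation and not a function of [s], since there is no such [j] when every
    point is at most [s], which is only known to be a null event. *)
Definition rank t x s (j : nat) := forall k, (t k x <= s)%R = (k < j)%N.

Variables (t : nat -> T -> R) (x : T).
Hypotheses (t0 : (0 < t 0%N x)%R) (t_lt : forall k, (t k x < t k.+1 x)%R).

Let t_homo : {homo (t^~ x) : i j / (i < j)%N >-> (i < j)%R}.
Proof. by apply: homo_ltn t_lt; exact: lt_trans. Qed.

Let t_mono : {mono (t^~ x) : i j / (i <= j)%N >-> (i <= j)%R}.
Proof. exact: le_mono t_homo. Qed.

Lemma rank0 : rank t x 0 0.
Proof.
by move=> k; rewrite ltn0 leNgt (lt_le_trans t0)// t_mono.
Qed.

Lemma rank_exists s c : (s < t c x)%R -> exists2 j, (j <= c)%N & rank t x s j.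
Proof.
move=> sc; have ex : exists k, (s < t k x)%R by exists c.
exists (ex_minn ex); case: ex_minnP => j sj jmin; first exact: jmin.
move=> k; rewrite leNgt; have [/jmin|] := boolP (s < t k x)%R.
  by rewrite leqNgt => /negbTE ->.
rewrite -leNgt => ks /=; rewrite ltnNge -t_mono -ltNge.
by rewrite (le_lt_trans ks).
Qed.

Let sum_ones j l : \sum_(0 <= k < l | (j <= k)%N) 1 = (l - j)%:R%:E :> \bar R.
Proof.
rewrite -[RHS](_ : \sum_(j <= k < l) 1 = _); last first.
  by rewrite sumEFin big_const_nat iter_addr_0.
by rewrite [RHS](big_nat_widenl j 0).
Qed.

Lemma point_count_rank s u j l : rank t x s j -> rank t x u l ->
  point_count t s u x = (l - j)%:R%:E.
Proof.
move=> sj ul; rewrite /point_count (@eseries_finite _ _ l); last first.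
  by move=> k lk; rewrite ul ltnNge lk andbF.
rewrite -sum_ones big_nat_cond [RHS]big_nat_cond; apply: eq_bigl => k.
by rewrite ltNge sj -leqNgt ul /=; case: (k < l)%N; rewrite ?andbT ?andbF.
Qed.

Lemma point_count_unbounded s u j : rank t x s j -> (forall k, t k x <= u)%R ->
  point_count t s u x = +oo.
Proof.
move=> sj ul; apply/eqyP => A A0; pose m := (Num.truncn A).+1.
have Am : (A <= m%:R)%R by rewrite ltW// truncnS_gt.
apply: (@le_trans _ _ m%:R%:E); first by rewrite lee_fin.
rewrite /point_count; apply: le_trans; last exact: (@nneseries_lim_ge _ _ _ _ (j + m)).
rewrite (eq_bigl (fun k => (j <= k)%N)); last first.
  by move=> k; rewrite ltNge sj -leqNgt ul andbT.
by rewrite sum_ones addKn.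
Qed.

(** With [j] points up to [s], the [c.+1]-st one comes after [s] iff [j <= c],
    and the [k.+1]-st one comes by [u] iff at least [k.+1 - j] points lie in
    ]s, u].  The latter is stated negatively, since the count may be infinite. *)
Lemma two_points_count s u c k : (0 <= s)%R -> (s < u)%R ->
  (s < t c x /\ t k x <= u)%R <->
  exists2 j, (j < c.+1)%N & point_count t 0 s x = j%:R%:E /\
    forall l, (l < k.+1 - j)%N -> point_count t s u x <> l%:R%:E.
Proof.
move=> s0 su; have rle s' j u' l : rank t x s' j -> rank t x u' l ->
    (s' < u')%R -> (j <= l)%N.
  move=> sj ul s'u'; case: j sj => // j sj.
  by rewrite -ul (le_trans _ (ltW s'u'))// sj.
split.
  move=> [/rank_exists[j jc sj] ku]; exists j => //.
  rewrite (point_count_rank rank0 sj) subn0; split=> // l lk.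
  have [[l' ul']|allu] := pselect (exists l', rank t x u l').
    rewrite (point_count_rank sj ul') => -[/eqP]; rewrite eqr_nat => /eqP.
    by move: ku; rewrite ul' => kl' E; have := rle _ _ _ _ sj ul' su; lia.
  rewrite (point_count_unbounded sj)// => i; rewrite leNgt; apply/negP.
  by move=> /rank_exists[l' _ ul']; apply: allu; exists l'.
move=> [j jc [cj lsu]].
have [j' sj'] : exists j', rank t x s j'.
  apply: contrapT => nosj; suff: point_count t 0 s x = +oo by rewrite cj.
  apply: point_count_unbounded rank0 _ => i; rewrite leNgt; apply/negP.
  by move=> /rank_exists[j' _ sj']; apply: nosj; exists j'.
move: cj; rewrite (point_count_rank rank0 sj') subn0 => -[/eqP].
rewrite eqr_nat => /eqP jj'; rewrite {}jj' in sj'.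
split; first by rewrite ltNge sj' -ltnNge ltnS -ltnS.
rewrite leNgt; apply/negP => /rank_exists[l lk ul].
have jl := rle _ _ _ _ sj' ul su.
apply: (lsu (l - j)%N); last exact: point_count_rank.
lia.
Qed.

End PointCount.

Section PoissonProcess.
Context {d : measure_display} {T : measurableType d} {R : realType}.
Variables (P : probability T R) (lambda : R) (t : nat -> {mfun T >-> R}).
Hypothesis lambda_gt0 : 0 < lambda.
Hypothesis t_poisson : poisson_points P lambda (fun k => t k : T -> R).
Local Open Scope ereal_scope.

Let count s u x := point_count (fun k => t k : T -> R) s u x.

Let measurable_count s u : measurable_fun setT (count s u).
Proof.
rewrite (_ : count s u = fun x => \sum_(k <oo | k \in xpredT)
    (if (s < t k x <= u)%R then 1 else 0)).
  apply: ge0_emeasurable_sum => [k x _ _|k _]; first by case: ifP.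
  apply: measurable_fun_ifT => //; apply: measurable_and.
    by apply: measurable_fun_ltr.
  by apply: measurable_fun_ler.
by apply/funext => x; rewrite /count /point_count eseries_mkcond.
Qed.

Let measurable_count_eq s u j : measurable [set x | count s u x = j%:R%:E].
Proof.
rewrite (_ : [set x | _] = setT `&` count s u @^-1` [set j%:R%:E]).
  exact: measurable_count.
by apply/seteqP; split=> x //= -[].
Qed.

Let measurable_point k (B : set R) : measurable B -> measurable (t k @^-1` B).
Proof. by move=> mB; rewrite -[X in measurable X]setTI; exact: measurable_funPT. Qed.

Let count_law s u j : (0 <= s)%R -> (s < u)%R ->
  P [set x | count s u x = j%:R%:E] = (poisson_weight (lambda * (u - s)) j)%:E.
Proof.
move=> s0 su; rewrite (poisson_points_law t_poisson)// /poisson_pmf.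
by rewrite mulr_gt0 ?subr_gt0.
Qed.

Let count00 j :
  [set x | count 0 0 x = j%:R%:E] = if j == 0%N then setT else set0.
Proof.
have c0 x : count 0 0 x = 0.
  by rewrite /count /point_count eseries0// => i _; rewrite lt_le_asym.
apply/seteqP; split=> x /=; rewrite c0.
  by move=> [/eqP]; rewrite eq_sym pnatr_eq0 => ->.
by case: eqP => [->|].
Qed.

Let count0_law s j : (0 <= s)%R ->
  P [set x | count 0 s x = j%:R%:E] = (poisson_weight (lambda * s) j)%:E.
Proof.
rewrite le_eqVlt => /orP[/eqP<-|s0]; last by rewrite count_law// subr0.
rewrite count00 mulr0 /poisson_weight oppr0 expR0 mulr1.
case: j => [|j] /=; first by rewrite probability_setT expr0 divr1.
by rewrite measure0 exprS !mul0r.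
Qed.

Let counts_law s u j l : (0 <= s)%R -> (s < u)%R ->
  P ([set x | count 0 s x = j%:R%:E] `&` [set x | count s u x = l%:R%:E])
  = (poisson_weight (lambda * s) j * poisson_weight (lambda * (u - s)) l)%:E.
Proof.
rewrite le_eqVlt => /orP[/eqP<-|s0] su.
  have := count0_law j (lexx 0%R); rewrite count00.
  case: j => [|j] /= E; first by rewrite setTI count_law// [RHS]EFinM -E probability_setT mul1e.
  by rewrite set0I [RHS]EFinM -E measure0 mul0e.
pose bound i : R := if i is i'.+1 then (s + i'%:R * (u - s))%R else 0%R.
have bound_lt i : (bound i < bound i.+1)%R.
  case: i => [|i] /=; first by rewrite mul0r addr0.
  by rewrite ltrD2l ltr_pM2r ?subr_gt0// ltr_nat.
have := @poisson_points_indep _ _ _ _ _ _ t_poisson 2%N bound (lexx _) bound_lt.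
pose B (i : 'I_2) : set (\bar R) :=
  if i == ord0 then [set j%:R%:E] else [set l%:R%:E].
move=> /indep_rvs_prod /(_ (ord0 |` [fset ord_max])%fset B).
have mB (i : 'I_2) : measurable (B i) by rewrite /B; case: ifP.
move=> /(_ mB); rewrite big_fsetU1 ?inE// big_seq_fset1.
rewrite /B eqxx /= mul0r addr0 mul1r [(s + _)%R]addrC subrK.
have s0' := ltW s0.
have -> : P (point_count (fun k => t k : T -> R) 0 s @^-1` [set j%:R%:E])
  = (poisson_weight (lambda * s) j)%:E.
  by have := count_law j (lexx 0%R) s0; rewrite subr0.
have -> : P (point_count (fun k => t k : T -> R) s u @^-1` [set l%:R%:E])
  = (poisson_weight (lambda * (u - s)) l)%:E by exact: count_law.
move=> E; rewrite [RHS]EFinM -{}E; congr (P _); apply/seteqP; split=> x.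
  move=> [cj cl] i /=; rewrite !inE => /orP[/eqP->|/eqP->] /=.
    by rewrite mul0r addr0.
  by rewrite mul0r addr0 mul1r [(s + _)%R]addrC subrK.
move=> cx; split.
  have := cx ord0; rewrite /= mul0r addr0; apply.
  by rewrite !inE.
have := cx ord_max; rewrite /= mul0r addr0 mul1r [(s + _)%R]addrC subrK; apply.
by rewrite !inE.
Qed.

Let tail_law s u j m : (0 <= s)%R -> (s < u)%R ->
  P ([set x | count 0 s x = j%:R%:E]
     `\` \big[setU/set0]_(l < m) [set x | count s u x = (l : nat)%:R%:E])
  = (poisson_weight (lambda * s) j
      * (1 - poisson_cdf (lambda * (u - s)) m))%:E.
Proof.
move=> s0 su; set A := [set x | count 0 s x = _].
pose B l := [set x | count s u x = l%:R%:E].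
have PA : P A = (poisson_weight (lambda * s) j * 1)%:E.
  by rewrite mulr1 count0_law.
rewrite measureD//; last 2 first.
- by apply: bigsetU_measurable => l _; exact: measurable_count_eq.
- by rewrite ltey_eq fin_num_measure//; exact: measurable_count_eq.
rewrite -(bigcup_mkord m B) setI_bigcupr bigcup_mkord.
rewrite (@measure_bigsetU_ord _ _ _ P m xpredT (fun l : 'I_m => A `&` B l)).
- rewrite (eq_bigr (fun l : 'I_m => (poisson_weight (lambda * s) j
      * poisson_weight (lambda * (u - s)) l)%:E)); last first.
    by move=> l _; exact: counts_law.
  by rewrite sumEFin [(_ * (1 - _))%R]mulrBr EFinB -PA mulr_sumr.
- by move=> l; apply: measurableI; exact: measurable_count_eq.
- apply/trivIsetP => l l' _ _ ll'; apply/seteqP; split=> // x [[_ cl] [_ cl']].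
  have : l%:R%:E = l'%:R%:E :> \bar R.
    by rewrite -(cl : count s u x = _) -(cl' : count s u x = _).
  by move=> [/eqP]; rewrite eqr_nat => /eqP/val_inj e; rewrite e eqxx in ll'.
- exact: measurable_count_eq.
Qed.

(** By [two_points_count] and the independence of the counts on [0, s] and
    ]s, u], summing over the number [j] of points up to [s]. *)
Lemma two_points_law s u c k : (0 <= s)%R -> (s < u)%R ->
  P [set x | (s < t c x)%R /\ (t k x <= u)%R] =
  (\sum_(j < c.+1) poisson_weight (lambda * s) j
    * (1 - poisson_cdf (lambda * (u - s)) (k.+1 - j)))%:E.
Proof.
move=> s0 su.
pose A j := [set x | count 0 s x = j%:R%:E]
   `\` \big[setU/set0]_(l < k.+1 - j) [set x | count s u x = (l : nat)%:R%:E].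
have mA j : measurable (A j).
  by apply: measurableD => //; exact: bigsetU_measurable.
transitivity (P (\big[setU/set0]_(j < c.+1) A j)).
  apply: eq_measure_ae.
  - apply: measurableI.
      have := measurable_point c (measurable_itv `]s, +oo[).
      rewrite (_ : _ @^-1` _ = [set x | (s < t c x)%R])//.
      by apply/seteqP; split=> x /=; rewrite in_itv /= andbT.
    have := measurable_point k (measurable_itv `]-oo, u]).
    by rewrite (_ : _ @^-1` _ = [set x | (t k x <= u)%R]).
  - by apply: bigsetU_measurable.
  - apply: filterS (poisson_points_ordered t_poisson) => x [t0 t_lt].
    rewrite -(bigcup_mkord c.+1 A).
    have countE := @two_points_count _ _ _ (fun k => t k : T -> R) x t0 t_lt s u c k s0 su.
    split=> [/countE[j jc [cj lj]]|[j /= jc [cj lj]]].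
      exists j => //; split => //.
      rewrite -(bigcup_mkord _ (fun l => [set x | count s u x = l%:R%:E])).
      by move=> [l /= /lj].
    apply/countE; exists j => //; split => // l lk csu; apply: lj.
    by rewrite -(bigcup_mkord _ (fun l => [set x | count s u x = l%:R%:E])); exists l.
rewrite (@measure_bigsetU_ord _ _ _ P c.+1 xpredT (fun j => A j))//; last first.
  apply/trivIsetP => i j _ _ ij; apply/seteqP; split=> // x [[/= ci _] [/= cj _]].
  move: cj; rewrite ci => -[/eqP]; rewrite eqr_nat => /eqP/val_inj e.
  by rewrite e eqxx in ij.
by rewrite -sumEFin; apply: eq_bigr => j _; exact: tail_law.
Qed.

End PoissonProcess.

(** * Observation times and the attacks between them *)

Section PartialSums.
Context {d : measure_display} {T : measurableType d} {R : realType}.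
Variables (P : probability T R) (mu : R) (delta : nat -> {mfun T >-> R}).
Hypothesis mu_gt0 : 0 < mu.
Hypothesis delta_law : forall l, exponential_rv P mu (delta l).
Hypothesis delta_indep : indep_rvs P (fun l => delta l : T -> R).

Definition partial_sum (i : nat) (x : T) : R := \sum_(l <- iota 0 i) delta l x.

Lemma measurable_partial_sum i : measurable_fun setT (partial_sum i).
Proof. exact: measurable_sum. Qed.

Lemma partial_sumS i x : partial_sum i.+1 x = partial_sum i x + delta i x.
Proof. by rewrite /partial_sum -addn1 iotaD big_cat big_seq1. Qed.

(** The partial sums are Erlang variables, and the distribution function of the
    [i]-th one at a given point tends to 0. *)
Lemma partial_sum_unbounded :
  {ae P, forall x, forall v : R, exists i, v <= partial_sum i x}.
Proof.
have bounded0 v : 0 < v -> P.-negligible [set x | forall i, partial_sum i x < v].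
  move=> v0; pose E i := [set x | partial_sum i x < v].
  have mE i : measurable (E i).
    have := measurable_partial_sum i measurableT (measurable_itv `]-oo, v[).
    by rewrite setTI (_ : _ @^-1` _ = E i).
  exists (\bigcap_i E i); split; [exact: bigcapT_measurable| |by move=> x Ex i _; exact: Ex].
  apply/eqP; rewrite eq_le measure_ge0 andbT.
  apply/lee_addgt0Pr => e e0; rewrite add0e.
  have [i _ /(_ i (leqnn i))] :=
    (cvgrPdist_le _ _).1 (@cvg_poisson_cdf1 R (mu * v)) e e0.
  have c1 : poisson_cdf (mu * v) i <= 1.
    by rewrite poisson_cdf_le1// mulr_ge0// ltW.
  rewrite /= ger0_norm ?subr_ge0// => ce.
  apply: (@le_trans _ _ (P (E i))).
    by apply: le_measure; rewrite ?inE//;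
      [exact: bigcapT_measurable|move=> x Ex; exact: Ex].
  rewrite (sum_exponential_cdf mu_gt0 delta_indep delta_law _ (iota_uniq _ _)).
  by rewrite v0 size_iota lee_fin.
have := negligible_bigcup (fun m => bounded0 m.+1%:R (ltr0Sn _ m)).
apply: negligibleS => x /= /existsNP[v /forallNP nv].
exists (Num.truncn v) => //= i; rewrite (lt_trans _ (truncnS_gt v))//.
by rewrite ltNge; apply/negP.
Qed.

End PartialSums.

Section MeasurableComparison.
Context {d : measure_display} {T : measurableType d} {R : realType}.
Variables f g : T -> R.
Hypotheses (mf : measurable_fun setT f) (mg : measurable_fun setT g).

Lemma measurable_set_ltr : measurable [set x | f x < g x].
Proof.
have := measurable_fun_ltr mf mg measurableT (Y := [set true]) I.
by rewrite setTI.
Qed.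

Lemma measurable_set_ler : measurable [set x | f x <= g x].
Proof.
have := measurable_fun_ler mf mg measurableT (Y := [set true]) I.
by rewrite setTI.
Qed.

End MeasurableComparison.

Section ObservationGaps.
Context {d : measure_display} {T : measurableType d} {R : realType}.
Variables (P : probability T R) (lambda mu : R).
Variables (t delta : nat -> {mfun T >-> R}).
Hypotheses (lambda_gt0 : 0 < lambda) (mu_gt0 : 0 < mu).
Hypothesis t_poisson : poisson_points P lambda (fun k => t k : T -> R).
Hypothesis delta_law : forall l, exponential_rv P mu (delta l).
Hypothesis delta_indep : indep_rvs P (fun l => delta l : T -> R).

Let r : R := lambda / (lambda + mu).
Let q : R := mu / (lambda + mu).

(** The observation times are taken as sums of the gaps, because independence is
    assumed for the gaps and the initial time is 0 only almost surely. *)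
Definition straddle (i c k : nat) : set T :=
  [set x | partial_sum delta i x < t c x /\ t k x <= partial_sum delta i.+1 x].

Let mS i : measurable_fun setT (partial_sum delta i).
Proof. exact: measurable_partial_sum. Qed.

Let S i : {mfun T >-> R} := mfun_Sub (mem_set (mS i)).

Let obs i : {mfun T >-> (R * R)%type} :=
  mfun_Sub (mem_set (measurable_fun_pair (mS i) (mS i.+1))).

Let att c k : {mfun T >-> (R * R)%type} :=
  mfun_Sub (mem_set (measurable_fun_pair (measurable_funPT (t c)) (measurable_funPT (t k)))).

Let C : set ((R * R) * (R * R)) := [set z | z.1.1 < z.2.1 /\ z.2.2 <= z.1.2].

Let mC : measurable C.
Proof.
apply: measurableI; [apply: measurable_set_ltr|apply: measurable_set_ler];
  exact: measurableT_comp.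
Qed.

Lemma measurable_straddle i c k : measurable (straddle i c k).
Proof. by apply: measurableI; [exact: measurable_set_ltr|exact: measurable_set_ler]. Qed.

Section Independence.
Variable F : set T.
Hypothesis mF : measurable F.
Hypothesis indepF : forall Et Ed : set T,
  sigma_family (fun k => t k : T -> R) Et ->
  sigma_family (fun l => delta l : T -> R) Ed ->
  (P (Ed `&` Et `&` F) = P Ed * P Et * P F)%E.

Let mSd i : @measurable_fun _ _ (g_sigma_algebraType
  (generators (fun l => delta l : T -> R))) R setT (partial_sum delta i).
Proof.
apply: measurable_sum => l.
exact: (@sigma_family_measurable_fun _ _ _ _ _ (fun l => delta l : T -> R) l).
Qed.

Lemma straddle_joint_law i c k : P (straddle i c k `&` F)
  = (P F * (distribution P (obs i) \x distribution P (att c k)) C)%E.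
Proof.
apply: (@joint_law_indep _ _ _ _ _ _ _ P (obs i) (att c k) F mF _ C mC) => A B mA mB.
apply: indepF.
- apply: (sigma_family_preimage _ mB); apply: measurable_fun_pair;
    exact: (@sigma_family_measurable_fun _ _ _ _ _ (fun k => t k : T -> R)).
- by apply: (sigma_family_preimage _ mA); exact: measurable_fun_pair.
Qed.

End Independence.

Hypothesis indep_td : forall Et Ed : set T,
  sigma_family (fun k => t k : T -> R) Et ->
  sigma_family (fun l => delta l : T -> R) Ed ->
  (P (Ed `&` Et) = P Ed * P Et)%E.

Let straddle_joint i c k : P (straddle i c k)
  = (distribution P (obs i) \x distribution P (att c k))%E C.
Proof.
rewrite -[straddle i c k]setIT (straddle_joint_law measurableT).
  by rewrite probability_setT mul1e.
by move=> Et Ed sEt sEd; rewrite setIT probability_setT mule1 indep_td.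
Qed.

(** The joint law of the two pairs of times is determined by rectangles, where
    the independence from [F] is assumed. *)
Lemma straddle_indep F i c k : measurable F ->
  (forall Et Ed : set T, sigma_family (fun k => t k : T -> R) Et ->
    sigma_family (fun l => delta l : T -> R) Ed ->
    (P (Ed `&` Et `&` F) = P Ed * P Et * P F)%E) ->
  P (straddle i c k `&` F) = (P (straddle i c k) * P F)%E.
Proof.
by move=> mF iF; rewrite straddle_joint_law// straddle_joint muleC.
Qed.

Let weight i j := (\int[P]_x (poisson_weight (lambda * Num.max 0 (S i x)) j)%:E)%E.

Let r_ge0 : 0 <= r. Proof. by rewrite divr_ge0// ltW// addr_gt0. Qed.

Let qE : q = 1 - r.
Proof.
have lm0 : lambda + mu != 0 by rewrite gt_eqF// addr_gt0.
by rewrite /q /r; field.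
Qed.

Let max_ge0 (v : R) : 0 <= lambda * Num.max 0 v.
Proof. by rewrite mulr_ge0 ?(ltW lambda_gt0)// le_max lexx. Qed.

Let measurable_scaled_max (f : T -> R) : measurable_fun setT f ->
  measurable_fun setT (fun x => lambda * Num.max 0 (f x)).
Proof. by move=> mf; apply: measurable_funM => //; exact: measurable_maxr. Qed.

Let measurable_weight j (f : T -> R) : measurable_fun setT f ->
  measurable_fun setT (fun x => (poisson_weight (lambda * Num.max 0 (f x)) j)%:E).
Proof.
move=> mf; apply/measurable_EFinP.
apply: (@measurableT_comp _ _ _ _ _ _ (fun v : R => poisson_weight v j)).
  exact: measurable_poisson_weight.
exact: measurable_scaled_max.
Qed.

Let measurable_tail m (f : T -> R) : measurable_fun setT f ->
  measurable_fun setT (fun x => (1 - poisson_cdf (lambda * Num.max 0 (f x)) m)%:E).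
Proof.
move=> mf; apply/measurable_EFinP; apply: measurable_funB => //.
apply: (@measurableT_comp _ _ _ _ _ _ (fun v : R => poisson_cdf v m)).
  exact: measurable_poisson_cdf.
exact: measurable_scaled_max.
Qed.

Let mean_tail i m :
  (\int[P]_x (1 - poisson_cdf (lambda * Num.max 0 (delta i x)) m)%:E = (r ^+ m)%:E)%E.
Proof.
have Ecdf : (\int[P]_x (poisson_cdf (lambda * Num.max 0 (delta i x)) m)%:E
    = (1 - r ^+ m)%:E)%E.
  under eq_integral do rewrite /poisson_cdf -sumEFin.
  rewrite ge0_integral_sum//; last 2 first.
  - by move=> j; exact: measurable_weight.
  - by move=> j x _; rewrite lee_fin poisson_weight_ge0.
  under eq_bigr do rewrite (expectation_poisson_exponential _ lambda_gt0 mu_gt0)//.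
  rewrite sumEFin -/r -/q -mulr_sumr qE; congr EFin.
  elim: m => [|m IHm]; first by rewrite big_ord0 mulr0 subrr.
  by rewrite big_ord_recr mulrDr IHm /= exprS; ring.
have tot : (1 = \int[P]_x (1 - poisson_cdf (lambda * Num.max 0 (delta i x)) m)%:E
    + \int[P]_x (poisson_cdf (lambda * Num.max 0 (delta i x)) m)%:E)%E.
  rewrite -ge0_integralD//.
  - under eq_integral do rewrite -EFinD subrK.
    by rewrite integral_cst// mul1e; exact/esym/probability_setT.
  - by move=> x _; rewrite lee_fin subr_ge0 poisson_cdf_le1.
  - exact: measurable_tail.
  - by move=> x _; rewrite lee_fin; apply: sumr_ge0 => l _; exact: poisson_weight_ge0.
  - apply/measurable_EFinP.
    apply: (@measurableT_comp _ _ _ _ _ _ (fun v : R => poisson_cdf v m)).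
      exact: measurable_poisson_cdf.
    exact: measurable_scaled_max.
move: tot; rewrite Ecdf => /(congr1 (fun z => z - (1 - r ^+ m)%:E)%E).
by rewrite addeK// -EFinB subKr => <-.
Qed.

(** Fix the two observation times; the number of attacks before the first one
    and in the gap are independent Poisson variables.  The gap is independent of the
    first observation time, and integrating over it leaves the probability
    [r ^+ (k.+1 - j)] that it contains at least [k.+1 - j] attacks. *)
Let straddle_law i c k : P (straddle i c k)
  = (\sum_(j < c.+1) weight i j * (r ^+ (k.+1 - j))%:E)%E.
Proof.
rewrite straddle_joint.
pose h x := (\sum_(j < c.+1)
  ((poisson_weight (lambda * Num.max 0 (S i x)) j)%:E
  * (1 - poisson_cdf (lambda * Num.max 0 (delta i x)) (k.+1 - j))%:E))%E.
have term_ge0 x j m : (0 <= (poisson_weight (lambda * Num.max 0 (S i x)) j)%:E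
    * (1 - poisson_cdf (lambda * Num.max 0 (delta i x)) m)%:E)%E.
  by rewrite mule_ge0// lee_fin ?subr_ge0 ?poisson_cdf_le1// poisson_weight_ge0.
have mterm j m : measurable_fun setT (fun x =>
    (poisson_weight (lambda * Num.max 0 (S i x)) j)%:E
    * (1 - poisson_cdf (lambda * Num.max 0 (delta i x)) m)%:E)%E.
  by apply: emeasurable_funM; [exact: measurable_weight|exact: measurable_tail].
transitivity (\int[P]_x h x)%E.
  rewrite /product_measure1 ge0_integral_distribution//; last first.
    exact: measurable_fun_xsection.
  apply: ge0_ae_eq_integral => //.
  - apply: measurableT_comp => //; exact: measurable_fun_xsection.
  - by apply: emeasurable_sum => j; exact: mterm.
  - by move=> x _; apply: sume_ge0 => j _; exact: term_ge0.
  have : {ae P, forall x, forall l, 0 < delta l x}.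
    by apply: ae_foralln => l; exact: exponential_rv_gt0 (delta_law l).
  apply: filterS => x delta_gt0 _.
  have s0 : 0 <= partial_sum delta i x.
    by rewrite /partial_sum sumr_ge0// => l _; exact: ltW.
  have su : partial_sum delta i x < partial_sum delta i.+1 x.
    by rewrite partial_sumS ltrDl.
  transitivity (P [set y | partial_sum delta i x < t c y /\
      t k y <= partial_sum delta i.+1 x]).
    rewrite /= /distribution /pushforward; congr (P _).
    by apply/seteqP; split=> y; rewrite /xsection /= inE.
  rewrite (two_points_law lambda_gt0 t_poisson c k s0 su) -sumEFin.
  apply: eq_bigr => j _; rewrite -EFinM /= !max_r//; last exact: ltW.
  by rewrite partial_sumS addrAC subrr add0r.
rewrite ge0_integral_sum//.
apply: eq_bigr => j _.
rewrite (@expectation_indepM _ _ _ _ _ _ _ P (S i) (delta i)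
  (fun v => (poisson_weight (lambda * Num.max 0 v) j)%:E)
  (fun v => (1 - poisson_cdf (lambda * Num.max 0 v) (k.+1 - j))%:E)).
- by rewrite mean_tail.
- apply/measurable_EFinP.
  apply: (@measurableT_comp _ _ _ _ _ _ (fun v : R => poisson_weight v j)).
    exact: measurable_poisson_weight.
  by apply: measurable_funM => //; exact: measurable_maxr.
- apply/measurable_EFinP; apply: measurable_funB => //.
  apply: (@measurableT_comp _ _ _ _ _ _ (fun v : R => poisson_cdf v (k.+1 - j))).
    exact: measurable_poisson_cdf.
  by apply: measurable_funM => //; exact: measurable_maxr.
- by move=> v; rewrite lee_fin poisson_weight_ge0.
- by move=> v; rewrite lee_fin subr_ge0 poisson_cdf_le1.
- move=> A B mA mB; apply: (indep_sum_one delta_indep) => //.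
    exact: iota_uniq.
  by rewrite mem_iota add0n ltnn andbF.
Qed.

(** The number [j] of attacks before the gap only has to be at most [c], whatever
    [k] is, and [k] enters each term of the sum over [j] through the factor
    [r ^+ (k.+1 - j)]. *)
Lemma straddle_geometric i c k : (c <= k)%N ->
  P (straddle i c k) = ((r ^+ (k - c))%:E * P (straddle i c c))%E.
Proof.
move=> ck; rewrite !straddle_law ge0_sume_distrr; last first.
  move=> j _; rewrite mule_ge0 ?lee_fin ?exprn_ge0// integral_ge0// => x _.
  by rewrite lee_fin poisson_weight_ge0.
apply: eq_bigr => j _; rewrite muleCA -EFinM -exprD; congr (_ * (r ^+ _)%:E)%E.
by have := ltn_ord j; lia.
Qed.

End ObservationGaps.

(** * Attacks up to the passage, along a path *)

Section UniqueHit.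
Context {T : Type} {R : realType}.
Implicit Types (A : nat -> set T) (x : T).

Lemma eq_indic_at (A B : set T) x : (A x <-> B x) -> \1_A x = \1_B x :> R.
Proof.
move=> AB; rewrite !indicE; have [Ax|nAx] := pselect (A x).
  by rewrite !mem_set//; exact/AB.
by rewrite !memNset// => /AB.
Qed.

Lemma eseries_indic_unique A x : (forall i i', A i x -> A i' x -> i = i') ->
  (\sum_(0 <= i <oo) (\1_(A i) x)%:E = (\1_(\bigcup_i A i) x)%:E :> \bar R)%E.
Proof.
move=> A1; have [[i Aix]|nA] := pselect (exists i, A i x).
  rewrite (@nneseriesD1 _ _ i)//.
  rewrite eseries0 ?adde0.
    by rewrite !indicE !mem_set//; exists i.
  move=> j _ /= ji; rewrite indicE memNset// => Ajx.
  by move: ji; rewrite (A1 _ _ Aix Ajx) eqxx.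
rewrite eseries0 => [|i _ _]; first by rewrite indicE memNset// => -[i _ Ai]; apply: nA; exists i.
by rewrite indicE memNset// => Ai; apply: nA; exists i.
Qed.

Lemma sum_indic_unique k A x : (forall i i', A i x -> A i' x -> i = i') ->
  (\sum_(i < k) (\1_(A i) x)%:E = (\1_(\bigcup_(i < k) A i) x)%:E :> \bar R)%E.
Proof.
move=> A1; pose B i := if (i < k)%N then A i else set0.
have B1 i i' : B i x -> B i' x -> i = i'.
  by rewrite /B; case: ifP => // _; case: ifP => // _; exact: A1.
have := eseries_indic_unique B1; rewrite (@eseries_finite _ _ _ k).
  rewrite big_mkord => E; transitivity (\sum_(i < k) (\1_(B i) x)%:E : \bar R)%E.
    by apply: eq_bigr => i _; rewrite /B ltn_ord.
  rewrite E; congr (\1_ _ x)%:E; apply/seteqP; split=> y [i].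
    by rewrite /B => _; case: ifP => // ik Ai; exists i.
  by move=> /= ik Ai; exists i => //; rewrite /B ik.
by move=> i ki _; rewrite /B ltnNge ki indicE in_set0.
Qed.

End UniqueHit.

Section Path.
Context {d : measure_display} {T : measurableType d} {R : realType}.
Variables (t : nat -> T -> R) (n : nat -> T -> nat) (w : nat -> nat -> T -> R).
Variables (tau : nat -> T -> R) (M : nat) (V : R) (x : T).
Hypotheses (M_ge1 : (1 <= M)%N) (V_gt0 : 0 < V).
Hypotheses (t0 : 0 < t 0%N x) (t_lt : forall k, t k x < t k.+1 x).
Hypotheses (tau0 : tau 0%N x = 0) (tau_lt : forall k, tau k x < tau k.+1 x).
Hypothesis tau_unbounded : forall v, exists i, v <= tau i x.
Hypothesis n_gt0 : forall k, (0 < n k x)%N.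
Hypothesis w_gt0 : forall k j, 0 < w k j x.

Let ins := inside n w M V.

Definition gap (i c k : nat) : set T :=
  [set y | tau i y < t c y /\ t k y <= tau i.+1 y].

Definition counted (k : nat) : set T :=
  inside n w M V k `|` \bigcup_(c < k) (crossing n w M V c `&` \bigcup_i gap i c k).

Let t_mono : {mono (t^~ x) : i j / (i <= j)%N >-> i <= j}.
Proof. apply: le_mono; apply: homo_ltn t_lt; exact: lt_trans. Qed.

Let tau_mono : {mono (tau^~ x) : i j / (i <= j)%N >-> i <= j}.
Proof. apply: le_mono; apply: homo_ltn tau_lt; exact: lt_trans. Qed.

Lemma gap_exists c : exists i, gap i c c x.
Proof.
have ex : exists i, t c x <= tau i x by exact: tau_unbounded.
case: (ex_minnP ex) => -[|i] ci imin.
  by move: ci; rewrite tau0 leNgt (lt_le_trans t0)// t_mono.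
exists i; split=> //; rewrite ltNge; apply/negP => /imin.
by rewrite ltnn.
Qed.

Lemma gap_unique c k i i' : (c <= k)%N -> gap i c k x -> gap i' c k x -> i = i'.
Proof.
have le e e' : (c <= k)%N -> gap e c k x -> gap e' c k x -> (e <= e')%N.
  move=> ck [ec _] [_ ke']; rewrite -ltnS ltnNge -tau_mono -ltNge.
  by rewrite (lt_le_trans ec)// (le_trans _ ke')// t_mono.
by move=> ck Gi Gi'; apply/eqP; rewrite eqn_leq (le i i')// (le i' i).
Qed.

Let attack_weight_ge0 k : 0 <= attack_weight n w k x.
Proof. by apply: sumr_ge0 => j _; exact: ltW. Qed.

Let nodes_after_homo : {homo (nodes_after n)^~ x : i j / (i <= j)%N}.
Proof.
apply: homo_leq => [|i j k|k]; [by []|exact: leq_trans|].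
by rewrite /nodes_after big_ord_recr leq_addr.
Qed.

Let weight_after_homo :
  {homo (weight_after n w)^~ x : i j / (i <= j)%N >-> i <= j}.
Proof.
apply: homo_leq => [|i j k|k]; [by []|exact: le_trans|].
by rewrite /weight_after big_ord_recr lerDl.
Qed.

Let insS i j : (i <= j)%N -> ins j x -> ins i x.
Proof.
move=> ij [Nj Wj]; split.
  exact: leq_ltn_trans (nodes_after_homo ij) Nj.
exact: le_lt_trans (weight_after_homo ij) Wj.
Qed.

Let ins0 : ins 0%N x.
Proof. by split; rewrite /nodes_after /weight_after big_ord0. Qed.

Let nodes_lost_rank s m : rank t x s m ->
  nodes_lost t n s%:E x = (nodes_after n m x)%:R%:E.
Proof.
move=> sm; rewrite /nodes_lost (@eq_eseriesl _ _ (fun k => (k < m)%N)); last first.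
  by move=> k; rewrite lee_fin sm.
rewrite (@eseries_finite _ _ _ m); last by move=> k; rewrite leqNgt => /negbTE ->.
rewrite big_mkord (eq_bigl xpredT); last by move=> k; rewrite ltn_ord.
by rewrite sumEFin /nodes_after natr_sum.
Qed.

Let weight_lost_rank s m : rank t x s m ->
  weight_lost t n w s%:E x = (weight_after n w m x)%:E.
Proof.
move=> sm; rewrite /weight_lost (@eq_eseriesl _ _ (fun k => (k < m)%N)); last first.
  by move=> k; rewrite lee_fin sm.
rewrite (@eseries_finite _ _ _ m); last by move=> k; rewrite leqNgt => /negbTE ->.
rewrite big_mkord (eq_bigl xpredT); last by move=> k; rewrite ltn_ord.
by rewrite sumEFin.
Qed.

Let nodes_lost_all s : (forall k, t k x <= s) ->
  (M%:R%:E <= nodes_lost t n s%:E x)%E.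
Proof.
move=> ts; apply: (@le_trans _ _ (\sum_(0 <= k < M) (n k x)%:R%:E)%E).
  rewrite sumEFin lee_fin -natr_sum ler_nat -[leqLHS]muln1 -[M in leqLHS]subn0.
  by rewrite -sum_nat_const_nat; apply: leq_sum => k _; exact: n_gt0.
rewrite [leLHS](eq_bigl (fun k => (t k x)%:E <= s%:E)%E); last first.
  by move=> k; rewrite lee_fin ts.
by apply: nneseries_lim_ge => k _ _; rewrite lee_fin.
Qed.

(** The attacks seen at [tau i] are the first [j] ones for the least [j] with
    [tau i x < t j x], and losses only grow.  If infinitely many attacks were seen,
    then so would be infinitely many nodes, as every attack hits at least one. *)
Let not_passedE i : ~ passed t n w tau M V i x <->
  exists2 m, tau i x < t m x & ins m x.
Proof.
rewrite /passed; split.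
  move=> /contrapT[/andP[_ NM] /andP[_ WV]].
  have [[m im]|all_le] := pselect (exists m, tau i x < t m x).
    have [j _ ij] := rank_exists t_lt im; exists j.
      by rewrite ltNge ij ltnn.
    move: NM WV; rewrite (nodes_lost_rank ij) (weight_lost_rank ij) !lte_fin.
    by rewrite ltr_nat.
  have := @nodes_lost_all (tau i x); rewrite leNgt NM => H; exfalso.
  suff : false by []; apply: H => k; rewrite leNgt; apply/negP => ik.
  by apply: all_le; exists k.
move=> [m im Dm]; apply; have [j jm ij] := rank_exists t_lt im.
have [Nj Wj] := insS jm Dm.
rewrite (nodes_lost_rank ij) (weight_lost_rank ij) !lee_fin !lte_fin ltr_nat Nj Wj.
by rewrite ler0n; split=> //; rewrite andbT; exact: sumr_ge0.
Qed.

Let le_passage_timeE k : ((t k x)%:E <= passage_time t n w tau M V x)%E <->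
  forall i, tau i x < t k x -> ~ passed t n w tau M V i x.
Proof.
rewrite /passage_time /passage_index; case: pselect => [h|noh] /=; last first.
  rewrite leey; split=> // _ i _ pi; apply: noh; exists i; exact/asboolP.
case: ex_minnP => m /asboolP pm mmin; rewrite lee_fin; split.
  move=> tkm i ik pi; have /mmin mi : `[< passed t n w tau M V i x >] by apply/asboolP.
  by move: (lt_le_trans ik tkm); rewrite ltNge tau_mono mi.
by move=> H; rewrite leNgt; apply/negP => /H.
Qed.

(** Attack [k] comes no later than the passage iff no observation before it has
    passed.  If attack [c < k] makes the crossing, the observations before [t c]
    have not passed and those from [t c] on have, so that the condition says that
    the observation following [t c] comes only at or after [t k]. *)
Lemma countedE k : ((t k x)%:E <= passage_time t n w tau M V x)%E <-> counted k x.
Proof.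
apply: (iff_trans (le_passage_timeE k)).
have [Dk|nDk] := pselect (ins k x).
  split=> [_|_ i ik]; first by left.
  by apply/not_passedE; exists k.
have [c ck [Dc nDc]] : exists2 c, (c < k)%N & ins c x /\ ~ ins c.+1 x.
  elim: k nDk => [/(_ ins0)//|k IHk] nD.
  have [Dk|nDk] := pselect (ins k x); first by exists k.
  by have [c ck Dc] := IHk nDk; exists c => //; exact: ltnW.
split.
  move=> H; right; exists c => //; split; first by split.
  have [i [ic ci]] := gap_exists c.
  exists i => //; split=> //; rewrite leNgt; apply/negP => /H /not_passedE[m im Dm].
  have mc : (m <= c)%N.
    by rewrite leqNgt; apply/negP => cm; apply: nDc; exact: insS cm Dm.
  by move: (le_lt_trans ci im); rewrite ltNge t_mono mc.
move=> [//|[c' /= c'k [[Dc' nDc'] [i _ [ic' ki]]]] j jk].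
apply/not_passedE; exists c' => //; apply: le_lt_trans ic'.
rewrite tau_mono -ltnS ltnNge; apply/negP.
by rewrite -tau_mono => /(le_trans ki); rewrite leNgt jk.
Qed.

Let crossing_unique c c' : crossing n w M V c x -> crossing n w M V c' x -> c = c'.
Proof.
have le e e' : crossing n w M V e x -> crossing n w M V e' x -> (e <= e')%N.
  move=> [De _] [_ nDe']; rewrite leqNgt; apply/negP => e'e.
  by apply: nDe'; exact: insS e'e De.
by move=> Dc Dc'; apply/eqP; rewrite eqn_leq (le c c')// (le c' c).
Qed.

(** At most one attack makes the crossing and at most one gap contains it, so the
    indicator of the union is the sum of the indicators. *)
Lemma indic_countedE k :
  ((\1_(inside n w M V k) x)%:E
   + \sum_(c < k) \sum_(0 <= i <oo) (\1_(crossing n w M V c `&` gap i c k) x)%:E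
   = (\1_(counted k) x)%:E :> \bar R)%E.
Proof.
have -> : (\sum_(c < k) \sum_(0 <= i <oo) (\1_(crossing n w M V c `&` gap i c k) x)%:E
    = (\1_(\bigcup_(c < k) (crossing n w M V c `&` \bigcup_i gap i c k)) x)%:E :> \bar R)%E.
  rewrite -sum_indic_unique; last by move=> c c' [+ _] [+ _]; exact: crossing_unique.
  apply: eq_bigr => c _; rewrite eseries_indic_unique ?setI_bigcupr//.
  by move=> i i' [_ Gi] [_ Gi']; exact: gap_unique (ltnW (ltn_ord c)) Gi Gi'.
rewrite /counted; have [Dk|nDk] := pselect (inside n w M V k x).
  rewrite !indicE (mem_set Dk) memNset ?adde0; first by rewrite mem_set//; left.
  by move=> [c /= ck [[_ nDc] _]]; apply: nDc; exact: insS ck Dk.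
rewrite !indicE (memNset nDk) add0e; set A := \bigcup_(_ in _) _.
have [Ax|nAx] := pselect (A x); first by rewrite !mem_set//; right.
by rewrite !memNset// => -[].
Qed.

Lemma nodes_at_passageE : nodes_at_passage t n w tau M V x
  = (\sum_(0 <= k <oo) (n k x)%:R%:E * (\1_(counted k) x)%:E)%E.
Proof.
rewrite /nodes_at_passage /nodes_lost eseries_mkcond.
apply: eq_eseriesr => k _; rewrite indicE.
case: ifPn => [/countedE ck|nck]; first by rewrite mem_set// mule1.
by rewrite memNset ?mule0// => /countedE; apply/negP.
Qed.

End Path.

(** * Summation over the attacks *)

Section Series.
Context {R : realType}.

Lemma eseries_EFin (u : nat -> R) (l : R) : series u @ \oo --> l ->
  (\sum_(0 <= k <oo) (u k)%:E = l%:E)%E.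
Proof.
move=> ul; rewrite (_ : (fun k => _) = EFin \o series u).
  by apply/cvg_lim => //; exact: cvg_EFin (nearW _ _) ul.
by apply/funext => k; rewrite /= sumEFin.
Qed.

Lemma eseries_geometric (b c : R) : 0 <= b -> b < 1 ->
  (\sum_(0 <= j <oo) (b ^+ j * c)%:E = (c / (1 - b))%:E)%E.
Proof.
move=> b0 b1; apply: eseries_EFin.
have := @cvg_geometric_series R c b; rewrite ger0_norm// => /(_ b1).
rewrite (_ : geometric c b = fun j => b ^+ j * c)//.
by apply/funext => j; rewrite /geometric /= mulrC.
Qed.

(** If a first phase is still running at step [k] with probability [y k], and at
    the end of it a second phase survives each step with probability [r], this is
    the probability that the second phase is not over at step [k]. *)
Definition delayed (r : R) (y : nat -> R) (k : nat) : R :=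
  y k + \sum_(c < k) (y c - y c.+1) * r ^+ (k - c).

Lemma delayedS r y k : delayed r y k.+1 = (1 - r) * y k.+1 + r * delayed r y k.
Proof.
rewrite /delayed big_ord_recr /= subSnn mulrDr mulr_sumr.
rewrite (eq_bigr (fun c : 'I_k => r * ((y c - y c.+1) * r ^+ (k - c)))); last first.
  move=> c _; rewrite mulrCA -exprS subSn//; exact: ltnW.
by ring.
Qed.

Lemma sum_delayed r y K : r < 1 ->
  \sum_(k < K.+1) delayed r y k
    = \sum_(k < K.+1) y k + r / (1 - r) * (y 0%N - delayed r y K).
Proof.
move=> r1; have q0 : 1 - r != 0 by rewrite subr_eq0 gt_eqF.
elim: K => [|K IHK].
  by rewrite !big_ord1 /delayed big_ord0 addr0 subrr mulr0 addr0.
rewrite big_ord_recr IHK [in RHS]big_ord_recr /= delayedS.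
by field.
Qed.

(** In the mean, the second phase adds [r / (1 - r)] steps, provided that it
    starts at all; the first phase starts running with probability [y 0] and
    is sure to end, since [y] vanishes from [M] on. *)
Lemma series_delayed r y M Y : 0 <= r -> r < 1 ->
  (forall k, (M <= k)%N -> y k = 0) -> \sum_(k < M) y k = Y ->
  series (delayed r y) @ \oo --> Y + r / (1 - r) * y 0%N.
Proof.
move=> r0 r1 yM <-; rewrite -(cvg_shiftn M.+1).
have delayedM m : delayed r y (M + m) = r ^+ m * delayed r y M.
  elim: m => [|m IHm]; first by rewrite addn0 mul1r.
  by rewrite addnS delayedS IHm yM ?mulr0 ?add0r ?mulrA -?exprS// -addnS leq_addr.
rewrite (_ : (fun m => _) = fun m => \sum_(k < M) y k
    + r / (1 - r) * (y 0%N - r ^+ m * delayed r y M)); last first.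
  apply/funext => m; rewrite /series /= big_mkord addnS [(m + M)%N]addnC.
  rewrite sum_delayed// delayedM; congr (_ + _).
  rewrite -addnS big_split_ord /= [X in _ + X]big1 ?addr0// => i _.
  by rewrite yM// leq_addr.
apply: cvgD; first exact: cvg_cst.
apply: cvgM; first exact: cvg_cst.
rewrite -[X in _ --> X]subr0; apply: cvgB; first exact: cvg_cst.
rewrite -[X in _ --> X](mul0r (delayed r y M)).
by apply: cvgM; [apply: cvg_expr; rewrite ger0_norm|exact: cvg_cst].
Qed.

End Series.

Section MeanBeforePassage.
Context {R : realType}.
Variables (a xi V : R).

Lemma inside_prob0 M k : (M <= k)%N -> inside_prob a xi V M k = 0.
Proof.
move=> Mk; rewrite /inside_prob big1// => m _.
by rewrite geometric_sum_pmf_gt ?mul0r// (leq_trans (ltn_ord m)).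
Qed.

Lemma inside_prob_at0 M : (0 < M)%N -> inside_prob a xi V M 0 = 1.
Proof.
case: M => // M _; rewrite /inside_prob big_ord_recl /= big1 => [|m _]; last first.
  by rewrite mul0r.
by rewrite /poisson_cdf big_ord0 subr0 mul1r addr0.
Qed.

(** Summing over [k] first turns the mass at [m] of the sum of [k] sizes into a
    renewal probability, which is constant for [m >= 1]. *)
Lemma sum_inside_prob M :
  \sum_(k < M.+1) inside_prob a xi V M.+1 k
    = 1 + a * \sum_(m < M) (1 - poisson_cdf (xi * V) m.+1).
Proof.
rewrite /inside_prob exchange_big /=.
under eq_bigr do rewrite -mulr_suml geometric_renewal//.
rewrite big_ord_recl /= /poisson_cdf big_ord0 subr0 mul1r; congr (_ + _).
by rewrite mulr_sumr.
Qed.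

(** Each weight of index [j < M] occurs [M - j] times on the left, and
    [j / j`! = 1 / (j - 1)!]. *)
Lemma sum_poisson_cdf v M : \sum_(m < M) poisson_cdf v m.+1
  = M%:R * expR (- v) * (\sum_(0 <= j < M) v ^+ j / (j`!)%:R)
    - expR (- v) * (\sum_(0 <= j < M) v ^+ j * inv_fact_pred R j).
Proof.
elim: M => [|M IHM].
  by rewrite big_ord0 mul0r mul0r big_nil mulr0 subrr.
rewrite big_ord_recr IHM /= !big_nat_recr//= poisson_cdfS.
rewrite (_ : poisson_cdf v M = expR (- v) * \sum_(0 <= j < M) v ^+ j / j`!%:R); last first.
  by rewrite /poisson_cdf big_mkord mulr_sumr; apply: eq_bigr => i _; rewrite mulrC.
have fE : M%:R / M`!%:R = inv_fact_pred R M.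
  case: M {IHM} => [|M] /=; first by rewrite mul0r.
  rewrite factS natrM invfM mulrA divff ?mul1r//.
rewrite -fE -natr1 /poisson_weight.
move: (\sum_(_ <= _ < _) _) (\sum_(_ <= _ < _) _) => A B.
by ring.
Qed.

End MeanBeforePassage.

(** * The mean number of nodes lost *)

Section FourFamilies.
Context {d : measure_display} {T : measurableType d} {R : realType}.
Variables (P : probability T R) (Ft Fn Fw Fd : set (set T)).
Hypothesis indep4 : mutual_indep P (tnth [tuple Ft; Fn; Fw; Fd]).

Lemma four_families_indep Et En Ew Ed : Ft Et -> Fn En -> Fw Ew -> Fd Ed ->
  (P (Et `&` En `&` Ew `&` Ed) = P Et * P En * P Ew * P Ed)%E.
Proof.
move=> Ht Hn Hw Hd.
pose i0 := @Ordinal 4 0 isT; pose i1 := @Ordinal 4 1 isT.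
pose i2 := @Ordinal 4 2 isT; pose i3 := @Ordinal 4 3 isT.
have all4 (i : 'I_4) : [\/ i = i0, i = i1, i = i2 | i = i3].
  case: i => -[|[|[|[|//]]]] ?; [constructor 1|constructor 2|constructor 3
    |constructor 4]; exact/val_inj.
have := @indep4 (i0 |` (i1 |` (i2 |` [fset i3])))%fset
  (tnth [tuple Et; En; Ew; Ed]).
rewrite !big_fsetU1 ?inE//= big_seq_fset1 !(tnth_nth setT) /= !muleA => <-.
  congr (P _); apply/seteqP; split=> x.
    by move=> [[[xt xn] xw] xd] i _; case: (all4 i) => ->.
  move=> H; split; first split; first split.
  - by apply: (H i0); rewrite /= !inE.
  - by apply: (H i1); rewrite /= !inE.
  - by apply: (H i2); rewrite /= !inE.
  - by apply: (H i3); rewrite /= !inE.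
by move=> i _; case: (all4 i) => ->.
Qed.

End FourFamilies.

Lemma sigma_familyT {d d' : measure_display} {T : measurableType d}
    {S : measurableType d'} {I : Type} (X : I -> T -> S) : sigma_family X setT.
Proof. by apply: (@measurableT _ (g_sigma_algebraType (generators X))). Qed.

Section MeanNodesAtPassage.
Context {d : measure_display} {T : measurableType d} {R : realType}.
Variables (P : probability T R) (lambda mu xi a V : R) (M : nat).
Variables (t tau : nat -> {mfun T >-> R}) (n : nat -> {mfun T >-> nat}).
Variable w : nat -> nat -> {mfun T >-> R}.
Hypotheses (lambda_gt0 : 0 < lambda) (mu_gt0 : 0 < mu) (xi_gt0 : 0 < xi).
Hypotheses (a_gt0 : 0 < a) (a_lt1 : a < 1) (M_ge1 : (1 <= M)%N) (V_gt0 : 0 < V).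
Hypothesis t_poisson : poisson_points P lambda (fun k => t k : T -> R).
Hypothesis n_law : forall k, geometric_rv P a (n k).
Hypothesis n_indep : indep_rvs P (fun k => n k : T -> nat).
Hypothesis w_law : forall k j, exponential_rv P xi (w k j).
Hypothesis w_indep :
  indep_rvs P (fun kj : nat * nat => w kj.1 kj.2 : T -> R).
Hypothesis tau_ordered :
  {ae P, forall x, tau 0%N x = 0 /\ forall k, tau k x < tau k.+1 x}.
Hypothesis tau_law : forall k, exponential_rv P mu (fun x => tau k.+1 x - tau k x).
Hypothesis tau_indep : indep_rvs P (fun k x => tau k.+1 x - tau k x).
Hypothesis families_indep : mutual_indep P (tnth [tuple
  sigma_family (fun k => t k : T -> R);
  sigma_family (fun k => n k : T -> nat);
  sigma_family (fun kj : nat * nat => w kj.1 kj.2 : T -> R);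
  sigma_family (fun k x => tau k.+1 x - tau k x)]).

Let r : R := lambda / (lambda + mu).

Local Notation tF := (fun k => t k : T -> R).
Local Notation nF := (fun k => n k : T -> nat).
Local Notation wF := (fun k j => w k j : T -> R).
Local Notation tauF := (fun k => tau k : T -> R).

Let measurable_gap l : measurable_fun setT (fun x => tau l.+1 x - tau l x).
Proof. exact: measurable_funB. Qed.

Let delta l : {mfun T >-> R} := mfun_Sub (mem_set (measurable_gap l)).

Let delta_law l : exponential_rv P mu (delta l).
Proof. exact: tau_law. Qed.

Let delta_indep : indep_rvs P (fun l => delta l : T -> R).
Proof. exact: tau_indep. Qed.

Let indep4 Et En Ew Ed :
  sigma_family (fun k => t k : T -> R) Et ->
  sigma_family (fun k => n k : T -> nat) En ->
  sigma_family (fun kj : nat * nat => w kj.1 kj.2 : T -> R) Ew ->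
  sigma_family (fun l => delta l : T -> R) Ed ->
  (P (Et `&` En `&` Ew `&` Ed) = P Et * P En * P Ew * P Ed)%E.
Proof. exact: four_families_indep families_indep Et En Ew Ed. Qed.

Let tT : sigma_family (fun k => t k : T -> R) setT.
Proof. exact: (@sigma_familyT _ _ _ _ _ (fun k => t k : T -> R)). Qed.

Let nT : sigma_family (fun k => n k : T -> nat) setT.
Proof. exact: (@sigma_familyT _ _ _ _ _ (fun k => n k : T -> nat)). Qed.

Let wT : sigma_family (fun kj : nat * nat => w kj.1 kj.2 : T -> R) setT.
Proof. exact: (@sigma_familyT _ _ _ _ _ (fun kj : nat * nat => w kj.1 kj.2 : T -> R)). Qed.

Let dT : sigma_family (fun l => delta l : T -> R) setT.
Proof. exact: (@sigma_familyT _ _ _ _ _ (fun l => delta l : T -> R)). Qed.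

Let indep_td Et Ed :
  sigma_family (fun k => t k : T -> R) Et ->
  sigma_family (fun l => delta l : T -> R) Ed ->
  (P (Ed `&` Et) = P Ed * P Et)%E.
Proof.
move=> Ht Hd; have := @indep4 Et setT setT Ed Ht nT wT Hd.
by rewrite !setIT probability_setT !mule1 setIC muleC.
Qed.

Let indep_nw En Ew :
  sigma_family (fun k => n k : T -> nat) En ->
  sigma_family (fun kj : nat * nat => w kj.1 kj.2 : T -> R) Ew ->
  (P (En `&` Ew `&` setT) = P En * P Ew * P setT)%E.
Proof.
move=> Hn Hw; have := @indep4 setT En Ew setT tT Hn Hw dT.
by rewrite !setIT setTI probability_setT !mule1 mul1e.
Qed.

Let indep_nw_straddle i c k En Ew :
  sigma_family (fun k => n k : T -> nat) En ->
  sigma_family (fun kj : nat * nat => w kj.1 kj.2 : T -> R) Ew ->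
  (P (En `&` Ew `&` straddle t delta i c k)
    = P En * P Ew * P (straddle t delta i c k))%E.
Proof.
move=> Hn Hw.
have nw := indep_nw Hn Hw; rewrite setIT probability_setT mule1 in nw.
have mEn : measurable En by apply: (sigma_family_sub _ Hn) => k'.
have mEw : measurable Ew by apply: (sigma_family_sub _ Hw) => kj.
rewrite setIC (straddle_indep indep_td); [|exact: measurableI|].
  by rewrite nw muleC.
move=> Et Ed Ht Hd; rewrite nw (_ : _ `&` (En `&` Ew) = Et `&` En `&` Ew `&` Ed).
  by rewrite indep4// -!muleA [RHS]muleC -!muleA.
by apply/seteqP; split=> x; [move=> [[? ?] [? ?]]|move=> [[[? ?] ?] ?]].
Qed.

Let b_ge0 : 0 <= 1 - a. Proof. by rewrite subr_ge0 ltW. Qed.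

Let r_ge0 : 0 <= r. Proof. by rewrite divr_ge0// ltW// addr_gt0. Qed.

Let r_lt1 : r < 1.
Proof. by rewrite ltr_pdivrMr ?addr_gt0// mul1r ltrDl. Qed.

Let partial_sum_tau i x : tau 0%N x = 0 -> partial_sum delta i x = tau i x.
Proof.
move=> tau0; elim: i => [|i IHi]; first by rewrite /partial_sum big_nil tau0.
by rewrite partial_sumS IHi /= addrC subrK.
Qed.

Let good_path : {ae P, forall x,
  [/\ 0 < t 0%N x /\ (forall k, t k x < t k.+1 x),
      tau 0%N x = 0 /\ (forall k, tau k x < tau k.+1 x),
      forall v : R, exists i, v <= tau i x,
      forall k, (0 < n k x)%N & forall k j, 0 < w k j x]}.
Proof.
have n_gt0 : {ae P, forall x, forall k, (0 < n k x)%N}.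
  apply: ae_foralln => k; exists (n k @^-1` [set 0%N]); split.
  - by rewrite -[X in measurable X]setTI; exact: measurable_funPT.
  - exact: geometric_rv0 a_gt0 a_lt1 (n_law k).
  - by move=> x /= /negP; rewrite -leqNgt leqn0 => /eqP.
have w_gt0 : {ae P, forall x, forall k j, 0 < w k j x}.
  apply: ae_foralln => k; apply: ae_foralln => j.
  exact: exponential_rv_gt0 (w_law k j).
have unbounded := partial_sum_unbounded mu_gt0 delta_law delta_indep.
have tordered := poisson_points_ordered t_poisson.
near=> x.
have taux : tau 0%N x = 0 /\ forall k, tau k x < tau k.+1 x by near: x.
have ub : forall v : R, exists i, v <= partial_sum delta i x by near: x.
split.
- by near: x.
- by [].
- by move=> v; have [i] := ub v; rewrite partial_sum_tau ?taux.1//; exists i.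
- by near: x.
- by near: x.
Unshelve. all: by end_near. Qed.

Let straddle_gap i c k x : tau 0%N x = 0 ->
  straddle t delta i c k x
    = gap (fun k => t k : T -> R) (fun k => tau k : T -> R) i c k x.
Proof. by move=> tau0; rewrite /straddle /gap /= !partial_sum_tau. Qed.

Let sum_straddle c : (\sum_(0 <= i <oo) P (straddle t delta i c c) = 1)%E.
Proof.
transitivity (\int[P]_x \sum_(0 <= i <oo) (\1_(straddle t delta i c c) x)%:E)%E.
  rewrite integral_nneseries//; last first.
    move=> i; apply/measurable_EFinP; apply: measurable_indic.
    exact: measurable_straddle.
  apply: eq_eseriesr => i _; rewrite integral_indic ?setIT//.
  exact: measurable_straddle.
transitivity (\int[P]_x (cst 1%E x))%E; last first.
  by rewrite integral_cst// mul1e; exact: probability_setT.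
apply: ge0_ae_eq_integral => //.
- rewrite (_ : (fun x => _) = fun x =>
    \sum_(i <oo | i \in xpredT) (\1_(straddle t delta i c c) x)%:E)%E//.
  apply: ge0_emeasurable_sum => [i x _ _|i _]; first by rewrite lee_fin.
  apply/measurable_EFinP; apply: measurable_indic.
  exact: measurable_straddle.
- by move=> x _; apply: nneseries_ge0 => i _ _; rewrite lee_fin.
apply: filterS good_path => x [[t0 t_lt] [tau0 tau_lt] ub _ _] _.
rewrite eseries_indic_unique => [|i i'].
  have [i Gi] := @gap_exists _ _ _ tF tauF x t0 t_lt tau0 ub c.
  rewrite indicE mem_set//; exists i => //.
  by rewrite straddle_gap.
by rewrite !straddle_gap//; exact: (@gap_unique _ _ _ tF tauF x t_lt tau_lt).
Qed.

(** The size of attack [k] is written as the number of [j] with [j < n k x]; these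
    events and [unnoticed] correspond to the two ways of being counted. *)
Let still_inside k j : set T :=
  inside nF wF M V k `&` n k @^-1` [set i | (j < i)%N] `&` setT.

Let unnoticed k j c i : set T :=
  crossing nF wF M V c `&` n k @^-1` [set i | (j < i)%N] `&` straddle t delta i c k.

Let inner k j x : \bar R := ((\1_(still_inside k j) x)%:E
  + \sum_(c < k) \sum_(0 <= i <oo) (\1_(unnoticed k j c i) x)%:E)%E.

Let measurable_still_inside k j : measurable (still_inside k j).
Proof. by apply: (measurable_inside (P := P) (a := a) (xi := xi)). Qed.

Let measurable_unnoticed k j (c : 'I_k) i : measurable (unnoticed k j c i).
Proof.
apply: (measurable_crossing (P := P) (a := a) (xi := xi)) => //.
  exact: measurable_straddle.
exact: indep_nw_straddle.
Qed.

Let measurable_indic_EFin (A : set T) : measurable A ->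
  measurable_fun setT (fun x => (\1_A x)%:E : \bar R).
Proof. by move=> mA; apply/measurable_EFinP; exact: measurable_indic. Qed.

Let measurable_unnoticed_sum k j (c : 'I_k) : measurable_fun setT
  (fun x => \sum_(0 <= i <oo) (\1_(unnoticed k j c i) x)%:E : \bar R)%E.
Proof.
rewrite (_ : (fun x => _) = fun x =>
  \sum_(i <oo | i \in xpredT) (\1_(unnoticed k j c i) x)%:E)%E//.
apply: ge0_emeasurable_sum => [i x _ _|i _]; first by rewrite lee_fin.
exact: measurable_indic_EFin.
Qed.

Let prob_still_inside k j :
  P (still_inside k j) = ((1 - a) ^+ j * inside_prob a xi V M k)%:E.
Proof.
rewrite (inside_law a_gt0 a_lt1 xi_gt0 V_gt0 n_law n_indep w_law w_indep)//.
rewrite probability_setT mule1 (geometric_rv_tail a_gt0 a_lt1 (n_law k)).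
by rewrite -EFinM mulrC.
Qed.

Let prob_unnoticed k j (c : 'I_k) i : P (unnoticed k j c i)
  = (((inside_prob a xi V M c - inside_prob a xi V M c.+1) * (1 - a) ^+ j
      * r ^+ (k - c))%:E * P (straddle t delta i c c))%E.
Proof.
rewrite (crossing_law a_gt0 a_lt1 xi_gt0 V_gt0 n_law n_indep w_law w_indep
  (measurable_straddle _ _ _ _ _) (@indep_nw_straddle i c k))//.
rewrite (geometric_rv_tail a_gt0 a_lt1 (n_law k)).
rewrite (straddle_geometric lambda_gt0 mu_gt0 t_poisson delta_law delta_indep
  indep_td i (ltnW (ltn_ord c))).
by rewrite !muleA -!EFinM.
Qed.

Let mean_inner k j : (\int[P]_x inner k j x
  = ((1 - a) ^+ j * delayed r (inside_prob a xi V M) k)%:E)%E.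
Proof.
rewrite /inner ge0_integralD//; last 3 first.
- exact: measurable_indic_EFin.
- move=> x _; apply: sume_ge0 => c _.
  by apply: nneseries_ge0 => i _ _; rewrite lee_fin.
- by apply: emeasurable_sum => c; exact: measurable_unnoticed_sum.
rewrite ge0_integral_sum//; last first.
  by move=> c x _; apply: nneseries_ge0 => i _ _; rewrite lee_fin.
rewrite /delayed mulrDr EFinD; congr (_ + _)%E.
  by rewrite integral_indic// setIT; exact: prob_still_inside.
rewrite mulr_sumr -sumEFin; apply: eq_bigr => c _.
rewrite integral_nneseries//; last by move=> i; exact: measurable_indic_EFin.
transitivity (\sum_(0 <= i <oo)
  (((inside_prob a xi V M c - inside_prob a xi V M c.+1) * (1 - a) ^+ j
    * r ^+ (k - c))%:E * P (straddle t delta i c c)))%E.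
  apply: eq_eseriesr => i _; rewrite integral_indic// setIT.
  exact: prob_unnoticed.
rewrite nneseriesZl; last by move=> i _; exact: measure_ge0.
by rewrite sum_straddle mule1; congr EFin; rewrite mulrA [in RHS](mulrC (_ ^+ j)).
Qed.

Let nodes_inner : {ae P, forall x,
  nodes_at_passage (fun k => t k) (fun k => n k) (fun k j => w k j)
    (fun k => tau k) M V x
  = (\sum_(0 <= k <oo) \sum_(0 <= j <oo) inner k j x)%E}.
Proof.
apply: filterS good_path => x [[t0 t_lt] [tau0 tau_lt] ub n_gt0 w_gt0].
rewrite (@nodes_at_passageE _ _ _ tF nF wF tauF M V x M_ge1 V_gt0 t0 t_lt tau0 tau_lt ub n_gt0 w_gt0).
apply: eq_eseriesr => k _.
have innerE j : inner k j x = if (j < n k x)%N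
    then (\1_(counted tF nF wF tauF M V k) x)%:E else 0%E.
  rewrite /inner; case: ifPn => jn; last first.
    rewrite indicE memNset; last by move=> [[_ /= nj] _]; rewrite nj in jn.
    rewrite add0e big1// => c _; rewrite eseries0// => i _ _.
    by rewrite indicE memNset//; move=> [[_ /= nj] _]; rewrite nj in jn.
  rewrite -(@indic_countedE _ _ _ tF nF wF tauF M V x t_lt tau_lt w_gt0).
  congr (_ + _)%E.
    by rewrite (@eq_indic_at _ _ _ (inside nF wF M V k)) => //; split=> [[[]]|].
  apply: eq_bigr => c _; apply: eq_eseriesr => i _.
  rewrite (@eq_indic_at _ _ _ (crossing nF wF M V c `&` gap tF tauF i c k)) => //.
  by rewrite /unnoticed /= straddle_gap//; split=> [[[]]|[]].
rewrite (eq_eseriesr (g := fun j => if (j < n k x)%N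
    then (\1_(counted tF nF wF tauF M V k) x)%:E else 0%E)); last first.
  by move=> j _; exact: innerE.
rewrite (@eseries_finite _ _ _ (n k x)); last first.
  by move=> j nj _; rewrite ltnNge nj.
rewrite (eq_big_nat _ _ (F2 := fun=> (\1_(counted tF nF wF tauF M V k) x)%:E)); last first.
  by move=> j /andP[_ ->].
rewrite sumEFin -EFinM; congr EFin.
by rewrite big_const_nat iter_addr_0 subn0 mulr_natl.
Qed.

Lemma mean_nodes_at_passage :
  (\int[P]_x nodes_at_passage (fun k => t k) (fun k => n k) (fun k j => w k j)
    (fun k => tau k) M V x
  = ((\sum_(k < M) inside_prob a xi V M k + lambda / mu) / a)%:E)%E.
Proof.
have inner_ge0 k j x : (0 <= inner k j x)%E.
  rewrite adde_ge0 ?lee_fin//; apply: sume_ge0 => c _.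
  by apply: nneseries_ge0 => i _ _; rewrite lee_fin.
have minner k j : measurable_fun setT (inner k j).
  apply: emeasurable_funD; first exact: measurable_indic_EFin.
  by apply: emeasurable_sum => c; exact: measurable_unnoticed_sum.
have msum k : measurable_fun setT (fun x => \sum_(0 <= j <oo) inner k j x)%E.
  rewrite (_ : (fun x => _) = fun x => \sum_(j <oo | j \in xpredT) inner k j x)%E//.
  by apply: ge0_emeasurable_sum.
rewrite (@ge0_integral_ae_nonmeasurable _ _ _ P _ _ _ _ _ nodes_inner); last 3 first.
- rewrite (_ : (fun x => _) = fun x =>
    \sum_(k <oo | k \in xpredT) \sum_(0 <= j <oo) inner k j x)%E//.
  by apply: ge0_emeasurable_sum => [k x _ _|//]; exact: nneseries_ge0.
- by move=> x; apply: nneseries_ge0 => k _ _; rewrite lee_fin.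
- by move=> x; apply: nneseries_ge0 => k _ _; exact: nneseries_ge0.
rewrite integral_nneseries//; last by move=> k x _; exact: nneseries_ge0.
rewrite (eq_eseriesr (g := fun k => (delayed r (inside_prob a xi V M) k / a)%:E));
    last first.
  move=> k _; rewrite integral_nneseries//.
  under eq_eseriesr do rewrite mean_inner.
  by rewrite eseries_geometric ?subKr// ltrBlDr ltrDl.
apply: eseries_EFin.
have cv := @series_delayed R r _ M _ r_ge0 r_lt1
  (fun k Mk => inside_prob0 a xi V Mk) erefl.
rewrite (_ : series _ = fun K => series (delayed r (inside_prob a xi V M)) K / a);
    last first.
  by apply/funext => K; rewrite /series /= mulr_suml.
apply: cvgM; last exact: cvg_cst.
rewrite inside_prob_at0// mulr1 in cv.
suff <- : r / (1 - r) = lambda / mu by [].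
have lm0 : lambda + mu != 0 by rewrite gt_eqF// addr_gt0.
have mu0 : mu != 0 by rewrite gt_eqF.
rewrite /r; field.
by rewrite mu0 lm0.
Qed.

End MeanNodesAtPassage.

Theorem theorem3p5 (R : realType) (d : measure_display) (T : measurableType d)
  (P : probability T R)
  (lambda mu xi a b V : R) (M : nat)
  (t : nat -> {RV P >-> R}) (n : nat -> {RV P >-> nat})
  (w : nat -> nat -> {RV P >-> R}) (tau : nat -> {RV P >-> R})
  (lambda_gt0 : 0 < lambda) (mu_gt0 : 0 < mu) (xi_gt0 : 0 < xi)
  (a_gt0 : 0 < a) (a_lt1 : a < 1) (bE : b = 1 - a)
  (M_ge1 : (1 <= M)%N) (V_gt0 : 0 < V)
  (t_poisson : poisson_points P lambda (fun k => t k : T -> R))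
  (n_law : forall k, geometric_rv P a (n k))
  (n_indep : indep_rvs P (fun k => n k : T -> nat))
  (w_law : forall k j, exponential_rv P xi (w k j))
  (w_indep : indep_rvs P (fun kj : nat * nat => w kj.1 kj.2 : T -> R))
  (tau_ordered :
    {ae P, forall x, tau 0%N x = 0 /\ forall k, tau k x < tau k.+1 x})
  (tau_law : forall k, exponential_rv P mu (fun x => tau k.+1 x - tau k x))
  (tau_indep : indep_rvs P (fun k x => tau k.+1 x - tau k x))
  (families_indep : mutual_indep P (tnth [tuple
     sigma_family (fun k => t k : T -> R);
     sigma_family (fun k => n k : T -> nat);
     sigma_family (fun kj : nat * nat => w kj.1 kj.2 : T -> R);
     sigma_family (fun k x => tau k.+1 x - tau k x)])) :
  (\int[P]_x nodes_at_passage (fun k => t k) (fun k => n k)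
               (fun k j => w k j) (fun k => tau k) M V x)%E
  = ((lambda + b * mu) / (a * mu) + M%:R
     - (M%:R - 1) * expR (- (xi * V))
         * (\sum_(0 <= j < M.-1) (xi * V) ^+ j / (j`!)%:R)
     + expR (- (xi * V))
         * (\sum_(0 <= j < M.-1) (xi * V) ^+ j * inv_fact_pred R j))%:E.
Proof.
rewrite (mean_nodes_at_passage lambda_gt0 mu_gt0 xi_gt0 a_gt0 a_lt1 M_ge1 V_gt0
  t_poisson n_law n_indep w_law w_indep tau_ordered tau_law tau_indep
  families_indep).
case: M M_ge1 => // M' _; rewrite sum_inside_prob sumrB sumr_const card_ord.
rewrite sum_poisson_cdf bE /= -natr1 addrK; congr EFin.
have a0 : a != 0 by rewrite gt_eqF.
have mu0 : mu != 0 by rewrite gt_eqF.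
move: (\sum_(_ <= _ < _) _) (\sum_(_ <= _ < _) _) => A B.
by field; rewrite a0 mu0.
Qed.
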